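(* For $i \in \{1,2\}$, let $n_i \in \mathbb{N}$, let $o_i$ be the origin of $\mathbb{R}^{n_i}$, let $\Lambda_i$ be an affine lattice of rank $n_i$ in $\mathbb{R}^{n_i}$ and let $B_i\subseteq\mathbb{R}^{n_i}$ be an $n_i$-dimensional polytope with $o_i \in B_i$. Let $0 < \mu < 1$. Let $n := n_1 + n_2$. Then, for the $n$-dimensional polytope $B:=B_1 \Diamond B_2$ and the affine lattice $\Lambda := (1-\mu) \Lambda_1 \times \mu \Lambda_2$ of rank $n$ in $\mathbb{R}^n$, the following assertions hold: (a) If $B_i$ is $\Lambda_i$-free for each $i \in \{1,2\}$, then $B$ is $\Lambda$-free. (b) If $B_i$ is maximal $\Lambda_i$-free for each $i \in \{1,2\}$, then $B$ is maximal $\Lambda$-free. (c) If $B_i$ is maximal $\Lambda_i$-free and has the unique-lifting property with respect to $\Lambda_i$ for each $i \in \{1,2\}$, then $B$ is maximal $\Lambda$-free and has the unique-lifting property with respect to $\Lambda$.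
   Context: For nonempty compact convex sets $K_1\subseteq\mathbb{R}^{n_1}$, $K_2\subseteq\mathbb{R}^{n_2}$, the coproduct is $K_1\Diamond K_2=\operatorname{conv}\bigl((K_1\times\{o_2\})\cup(\{o_1\}\times K_2)\bigr)\subseteq\mathbb{R}^{n_1}\times\mathbb{R}^{n_2}=\mathbb{R}^{n_1+n_2}$, with $o_i$ the origin of $\mathbb{R}^{n_i}$. An affine lattice of rank $n$ in $\mathbb{R}^n$ is a translate of a lattice of rank $n$. For an affine lattice $\Lambda$ of rank $n$ in $\mathbb{R}^n$, a set $B\subseteq\mathbb{R}^n$ is $\Lambda$-free if it is $n$-dimensional, closed, convex and $\operatorname{int}(B)\cap\Lambda=\emptyset$; it is maximal $\Lambda$-free if it is inclusion-maximal among $\Lambda$-free sets. For $f\in\mathbb{R}^n\setminus\Lambda$, a cut-generating pair for $f$ (with respect to $\Lambda$) is a pair of nonnegative functions $\psi,\pi:\mathbb{R}^n\to\mathbb{R}$ such that for all integers $k,\ell\ge 0$, not both zero, and all matrices $R\in\mathbb{R}^{n\times k}$ with columns $r_1,\dots,r_k$ and $P\in\mathbb{R}^{n\times\ell}$ with columns $p_1,\dots,p_\ell$, the inequality $\sum_i\psi(r_i)s_i+\sum_j\pi(p_j)y_j\ge1$ holds for all $(s,y)\in\mathbb{R}_+^k\times\mathbb{Z}_+^\ell$ with $f+Rs+Py\in\Lambda$. Then $\pi$ is a lifting of $\psi$; a minimal lifting is a lifting $\pi$ of $\psi$ such that no other, distinct lifting $\pi'$ of $\psi$ satisfies $\pi'\le\pi$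 pointwise. For $f\in\operatorname{int}(B)$, $\phi_{B-f}(r)=\inf\{\rho>0:r/\rho\in B-f\}$ is the gauge function of $B-f$. A maximal $\Lambda$-free polytope $B$ has the unique-lifting property with respect to $\Lambda$ if for every (equivalently, for some) $f\in\operatorname{int}(B)$ the function $\phi_{B-f}$ has exactly one minimal lifting. Known characterization from earlier literature, used by the paper as a working description: $\phi_{B-f}$ (with $f\in\operatorname{int}(B)$) has exactly one minimal lifting if and only if $R_\Lambda(B,f)+\Lambda=\mathbb{R}^n$, where $R_\Lambda(B,f)=\bigcup_F\bigcup_{z\in F\cap\Lambda}\bigl[\operatorname{conv}(\{f\}\cup F)\cap(z+f-\operatorname{conv}(\{f\}\cup F))\bigr]$, with $F$ ranging over all faces of $B$ other than $\emptyset$ and $B$. *)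

(* Defs.v *)
From mathcomp Require Import all_boot all_order all_algebra.
From mathcomp Require Import all_classical all_reals all_analysis.

Set Implicit Arguments.
Unset Strict Implicit.
Unset Printing Implicit Defensive.

Import Order.TTheory GRing.Theory Num.Theory.
Import numFieldNormedType.Exports.

Local Open Scope classical_set_scope.
Local Open Scope ring_scope.

(* R^n is 'rV[R]_n, and R^n1 x R^n2 = R^(n1+n2) is realised by row_mx. *)

Section ConvexSets.
Context {R : realType} {n : nat}.
Implicit Types A B K : set 'rV[R]_n.

Definition conv_hull A : set 'rV[R]_n := smallest (@convex_set R 'rV[R]_n) A.

Definition affine_hull A : set 'rV[R]_n :=
  [set x | exists (k : nat) (c : 'I_k -> R) (a : 'I_k -> 'rV[R]_n),
     [/\ forall i, A (a i), \sum_i c i = 1 & x = \sum_i c i *: a i]].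

(* A is n-dimensional, where dim A is the dimension of its affine hull *)
Definition full_dimensional A : Prop := affine_hull A = setT.

Definition polytope B : Prop := exists2 V, finite_set V & B = conv_hull V.

Definition gauge K (r : 'rV[R]_n) : R :=
  inf [set rho : R | 0 < rho /\ K (rho^-1 *: r)].

End ConvexSets.

Definition coproduct {R : realType} {n1 n2 : nat}
    (K1 : set 'rV[R]_n1) (K2 : set 'rV[R]_n2) : set 'rV[R]_(n1 + n2) :=
  conv_hull ([set row_mx x (0 : 'rV[R]_n2) | x in K1] `|`
             [set row_mx (0 : 'rV[R]_n1) y | y in K2]).

Section Lattices.
Context {R : realType} {n : nat}.
Implicit Types L B : set 'rV[R]_n.

(* lattice of rank n: the integer combinations of n linearly independent
   vectors, here the rows of A *)
Definition lattice L : Prop :=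
  exists2 A : 'M[R]_n, A \in unitmx &
    L = [set map_mx (intr : int -> R) z *m A | z in [set: 'rV[int]_n]].

Definition affine_lattice L : Prop :=
  exists (t : 'rV[R]_n) (L0 : set 'rV[R]_n),
    lattice L0 /\ L = [set t + x | x in L0].

Definition lattice_free L B : Prop :=
  [/\ full_dimensional B, closed B, @convex_set R 'rV[R]_n B &
      B° `&` L = set0].

Definition maximal_lattice_free L B : Prop :=
  lattice_free L B /\
  forall C : set 'rV[R]_n, lattice_free L C -> B `<=` C -> C = B.

End Lattices.

Definition scaled_prod {R : realType} {n1 n2 : nat} (mu : R)
    (L1 : set 'rV[R]_n1) (L2 : set 'rV[R]_n2) : set 'rV[R]_(n1 + n2) :=
  [set v | exists x y, [/\ L1 x, L2 y & v = row_mx ((1 - mu) *: x) (mu *: y)]].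

Section Liftings.
Context {R : realType} {n : nat}.
Implicit Types (L B : set 'rV[R]_n) (f : 'rV[R]_n) (psi pi : 'rV[R]_n -> R).

(* The families r and p are the columns of the matrices of the mixed-integer
   model f + R s + P y \in L with s real and y integer, both nonnegative. *)
Definition cut_generating_pair L f psi pi : Prop :=
  [/\ ~ L f, forall x, 0 <= psi x, forall x, 0 <= pi x &
    forall (k l : nat) (r : 'I_k -> 'rV[R]_n) (p : 'I_l -> 'rV[R]_n),
      (k, l) <> (0%N, 0%N) ->
      forall (s : 'I_k -> R) (y : 'I_l -> nat), (forall i, 0 <= s i) ->
        L (f + \sum_i s i *: r i + \sum_j (y j)%:R *: p j) ->
        1 <= \sum_i psi (r i) * s i + \sum_j pi (p j) * (y j)%:R].

Definition lifting L f psi pi : Prop := cut_generating_pair L f psi pi.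

Definition minimal_lifting L f psi pi : Prop :=
  lifting L f psi pi /\
  forall pi', lifting L f psi pi' -> (forall x, pi' x <= pi x) -> pi' = pi.

Definition unique_lifting L B : Prop :=
  forall f, B° f ->
    exists! pi, minimal_lifting L f (gauge [set x - f | x in B]) pi.

End Liftings.

(* Main.v *)
Require Import Defs.
From mathcomp Require Import all_boot all_order all_algebra.
From mathcomp Require Import all_classical all_reals all_analysis.
From mathcomp Require Import ring lra zify.
Import Order.TTheory GRing.Theory Num.Theory.
Import numFieldNormedType.Exports.
Local Open Scope classical_set_scope.
Local Open Scope ring_scope.

Set Implicit Arguments.
Unset Strict Implicit.
Unset Printing Implicit Defensive.

(** A point of the coproduct [B] of [B1] and [B2] has the form
    [((1 - t) b1, t b2)] with [0 <= t <= 1].  All three assertions compare the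
    parameter [t] of a point with the parameter [mu] of the lattice.

    (a) A lattice point [((1 - mu) x1, mu x2)] is not interior to [B].  Since
    [x_i] is not interior to [B_i], some functional [c_i] is maximal over [B_i]
    at [x_i]; its value there is nonnegative because [0] is in [B_i].  If both
    values are positive, rescale them to [1]: then [(c1, c2)] is at most [1] on
    [B] and equals [(1 - mu) + mu = 1] at the lattice point.  If one value is
    zero, that functional alone, extended by zero, supports [B] there.

    (b) A compact maximal lattice-free set is cut out by finitely many
    half-spaces, each touching it in a lattice point where the normal is unique
    up to a factor ([maximal_lattice_free_facets]): lattice points supply the
    half-spaces, and maximality makes an irredundant family of them smooth.
    Let [C] be lattice-free and contain [B].  Take facets of [B1] and [B2] with
    normals [p], [q] and smooth lattice points [z1], [z2].  The lattice point
    [((1 - mu) z1, mu z2)] is not interior to [C], and a functional supporting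
    [C] there restricts to supports of [B1] at [z1] and of [B2] at [z2], so it is
    made of multiples of [p] and [q] ([coproduct_facet_support]).  Hence [C]
    satisfies every inequality obtained from a pair of facets, and eliminating
    [t] from the description of [B] shows that these inequalities define [B].

    (c) Let [psi] be the gauge of [B - f].  Uniqueness of the minimal lifting is
    equivalent to the following property, here called [covering]: every [r] has
    a translate [r + u] by a period of the lattice and a lattice point [w] with
    [psi (r + u) + psi (w - f - r - u) <= 1].  This says that [f + r + u] lies in
    the region [R(B, f)], without mentioning faces.  If it holds, the minimum of
    [psi] over translates is the least lifting
    ([covering_unique_lifting]).  Conversely, by Zorn's lemma a unique minimal
    lifting [pi] is the least lifting.  If the property failed at [r], only
    solutions that use [r] at least twice could force the value of [pi] at [r],
    whence [pi r <= 1/2]; the same holds at the reflected point [w - f - r], and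
    the two values add up to at least [1].  So both are [1/2], which forces
    [f + 2 r] to be a lattice point; but the property fails on an open set while
    the lattice is discrete ([least_lifting_covering]).

    Finally the property passes to coproducts at every interior point
    [g = (g1, g2)] of [B], where [g_i] is interior to [B_i].  Call the minimum of
    [psi] over the translates of [r] the height of [r].  Coverings of height
    [s1] and [s2] in the two factors combine to one of height
    [(1 - mu) s1 + mu s2], after displacing the first point along [g1]
    proportionally to [s2] and the second along [g2] proportionally to [s1].
    That the displacements and the heights agree is a fixed point problem in one
    real variable, solved by the intermediate value theorem
    ([matching_heights]). *)

(** * Supporting hyperplanes of compact convex sets *)

Section Geometry.
Context {R : realType} {n : nat}.
Implicit Types (u v x y z c : 'rV[R]_n) (K : set 'rV[R]_n).

Lemma convexP K : @convex_set R 'rV[R]_n K <->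
  forall x y t, K x -> K y -> 0 <= t <= 1 -> K (t *: x + (1 - t) *: y).
Proof.
split=> [cK x y t Kx Ky /andP[t0 t1]|cK x y t].
  have t01 : Itv.spec (@Itv.num_sem R) (Itv.Real `[0%Z, 1%Z]) t.
    by apply/andP; split; [rewrite num_real|rewrite /= in_itv /= t0 t1].
  have /(_ (Itv.mk t01)) := cK x y _ (mem_set Kx) (mem_set Ky).
  by move/set_mem.
rewrite !inE => Kx Ky; apply: cK => //.
by rewrite ge0 le1.
Qed.

Lemma interiorP K z :
  K° z <-> exists2 e, 0 < e & forall y, `|y - z| < e -> K y.
Proof.
split=> [/nbhs_ballP[e /= e0 He]|[e e0 He]].
  by exists e => // y yz; apply: He; rewrite -ball_normE /= distrC.
by apply/nbhs_ballP; exists e => //= y; rewrite -ball_normE /= distrC => /He.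
Qed.

Definition dot u v : R := (u *m v^T) 0 0.

Lemma dotE u v : dot u v = \sum_i u 0 i * v 0 i.
Proof. by rewrite /dot mxE; apply: eq_bigr => i _; rewrite mxE. Qed.

Lemma dotC u v : dot u v = dot v u.
Proof. by rewrite !dotE; apply: eq_bigr => i _; rewrite mulrC. Qed.

Lemma dotDl u v x : dot (u + v) x = dot u x + dot v x.
Proof. by rewrite /dot mulmxDl mxE. Qed.
Lemma dotDr u v x : dot x (u + v) = dot x u + dot x v.
Proof. by rewrite !(dotC x) dotDl. Qed.
Lemma dotZl a u x : dot (a *: u) x = a * dot u x.
Proof. by rewrite /dot -scalemxAl mxE. Qed.
Lemma dotZr a u x : dot x (a *: u) = a * dot x u.
Proof. by rewrite !(dotC x) dotZl. Qed.
Lemma dotNl u x : dot (- u) x = - dot u x.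
Proof. by rewrite -scaleN1r dotZl mulN1r. Qed.
Lemma dotNr u x : dot x (- u) = - dot x u.
Proof. by rewrite !(dotC x) dotNl. Qed.
Lemma dot0l x : dot 0 x = 0.
Proof. by rewrite -(scale0r (0 : 'rV[R]_n)) dotZl mul0r. Qed.
Lemma dot0r x : dot x 0 = 0.
Proof. by rewrite dotC dot0l. Qed.
Definition dotB := (dotDl, dotDr, dotNl, dotNr, dotZl, dotZr, dot0l, dot0r).

Lemma dot_ge0 u : 0 <= dot u u.
Proof. by rewrite dotE sumr_ge0 // => i _; rewrite -expr2 sqr_ge0. Qed.

Lemma dot_eq0 u : dot u u = 0 -> u = 0.
Proof.
rewrite dotE => /eqP; rewrite psumr_eq0 => [/allP H|i _]; last first.
  by rewrite -expr2 sqr_ge0.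
apply/rowP => i; rewrite mxE; apply/eqP.
by have := H i (mem_index_enum i); rewrite -expr2 sqrf_eq0.
Qed.

Lemma dot_gt0 u : u != 0 -> 0 < dot u u.
Proof.
by move=> u0; rewrite lt_def dot_ge0 andbT; apply: contra_neq u0 => /dot_eq0.
Qed.

Lemma coord_le_norm u i : `|u 0 i| <= `|u|.
Proof.
by rewrite [leRHS]/Num.norm /= mx_normrE; apply/bigmax_geP; right; exists (0, i).
Qed.

Lemma norm_le_coord u M : 0 <= M -> (forall i, `|u 0 i| <= M) -> `|u| <= M.
Proof.
move=> M0 H; rewrite /Num.norm /= mx_normrE; apply/bigmax_leP; split=> // -[i j] _.
by rewrite (ord1 i); apply: H.
Qed.

Lemma dot_le u v : `|dot u v| <= n%:R * `|u| * `|v|.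
Proof.
rewrite dotE; apply: le_trans (ler_norm_sum _ _ _) _.
apply: (@le_trans _ _ (\sum_(i < n) `|u| * `|v|)).
  by apply: ler_sum => i _; rewrite normrM ler_pM // coord_le_norm.
by rewrite sumr_const card_ord -mulrA mulr_natl.
Qed.

Lemma dot_continuous c : continuous (dot c).
Proof.
rewrite (_ : dot c = fun y => \sum_i c 0 i * y 0 i); last exact/funext/dotE.
apply: continuous_big => [|i _]; first exact: (@add_continuous R^o).
move=> y.
apply: (@cvgM R _ (nbhs y) _ (fun=> c 0 i) (fun y : 'rV[R]_n => y 0 i)).
  exact: cvg_cst.
exact: coord_continuous.
Qed.

Lemma sqr_dot_continuous x : continuous (fun y => dot (x - y) (x - y)).
Proof.
rewrite (_ : (fun _ => _) =
  fun y => \sum_i (x 0 i - y 0 i) * (x 0 i - y 0 i)); last first.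
  by apply/funext => y; rewrite dotE; apply: eq_bigr => i _; rewrite !mxE.
apply: continuous_big => [|i _]; first exact: (@add_continuous R^o).
move=> y; have H : (fun y : 'rV[R]_n => x 0 i - y 0 i) z @[z --> y] -->
    x 0 i - y 0 i.
  apply: (@cvgB R R^o _ (nbhs y) _ (fun=> x 0 i) (fun y : 'rV[R]_n => y 0 i)).
    exact: cvg_cst.
  exact: coord_continuous.
exact: (cvgM H H).
Qed.

(** First-order optimality: moving from the nearest point [b] towards [y] by a
    small [t] changes the squared distance by [- 2 t d + t^2 e], so [d <= 0]. *)
Lemma nearest_point K x : compact K -> @convex_set R 'rV[R]_n K -> K !=set0 ->
  exists2 b, K b & forall y, K y -> dot (x - b) (y - b) <= 0.
Proof.
move=> cK /convexP vK K0.
have [b /set_mem Kb bmin] : exists2 b, b \in K &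
    forall y, y \in K -> dot (x - b) (x - b) <= dot (x - y) (x - y).
  by apply: compact_EVT_min => //; apply/continuous_subspaceT/sqr_dot_continuous.
exists b => // y Ky; rewrite leNgt; apply/negP => d0.
set d := dot _ _ in d0; set e := dot (y - b) (y - b).
have e0 : 0 <= e by exact: dot_ge0.
have de : 0 < d + e by rewrite ltr_wpDr.
(* With this step [t e < d], so the linear decrease beats the quadratic term;
   the denominator also covers [e = 0]. *)
set t := d / (d + e).
have t0 : 0 < t by rewrite divr_gt0.
have t1 : t <= 1 by rewrite ler_pdivrMr // mul1r lerDl.
have Kt : K (t *: y + (1 - t) *: b) by apply: vK; rewrite ?(ltW t0).
have := bmin _ (mem_set Kt).
have -> : x - (t *: y + (1 - t) *: b) = (x - b) - t *: (y - b).
  by apply/rowP => i; rewrite !mxE; ring.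
have sq (w v : 'rV[R]_n) : dot (w - t *: v) (w - t *: v) =
    dot w w - 2 * t * dot w v + t ^+ 2 * dot v v.
  by rewrite !dotB (dotC v w); ring.
rewrite sq -/d -/e => h.
have tde : t * (d + e) = d by rewrite /t mulfVK // gt_eqF.
have h2 : t * (2 * d - t * e) <= 0 by lra.
have : 2 * d - t * e <= 0 by rewrite -(pmulr_rle0 _ t0).
have : t * d >= 0 by rewrite mulr_ge0 // ltW.
lra.
Qed.

(** A point [z] outside the interior is a limit of points outside [K], and those
    are separated by the direction to their nearest point.  The unit normals
    live in a compact set; any cluster point of them as [x] tends to [z] supports
    [K] at [z].  Nonemptiness of [K] is what excludes dimension 0. *)
Lemma supporting_hyperplane K z :
  compact K -> @convex_set R 'rV[R]_n K -> K !=set0 -> ~ K° z ->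
  exists2 c, c != 0 & forall y, K y -> dot c (y - z) <= 0.
Proof.
move=> cK vK K0 Kz.
have sep x : ~ K x -> exists u, `|u| = 1 /\ forall y, K y -> dot u (y - x) <= 0.
  move=> Kx; have [b Kb bn] := nearest_point x cK vK K0.
  have xb : x - b != 0 by rewrite subr_eq0; apply: contra_not_neq Kx => ->.
  exists (`|x - b|^-1 *: (x - b)); split.
    by rewrite normrZ normfV normr_id mulVf // normr_eq0.
  move=> y Ky; rewrite dotZl pmulr_rle0 ?invr_gt0 ?normr_gt0 //.
  have -> : y - x = (y - b) - (x - b) by apply/rowP => i; rewrite !mxE; ring.
  by rewrite dotDr dotNr subr_le0 (le_trans (bn y Ky)) // dot_ge0.
pose N x := if pselect (~ K x) is left h then projT1 (cid (sep x h)) else 0.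
have N1 x : ~ K x -> `|N x| = 1.
  by rewrite /N; case: pselect => // h _; case: cid => u [].
have Nle x y : ~ K x -> K y -> dot (N x) (y - x) <= 0.
  by rewrite /N; case: pselect => // h _; case: cid => u [_] /= H; exact: H.
pose U := [set u : 'rV[R]_n | `|u| = 1].
have cU : compact U.
  apply: bounded_closed_compact.
    by exists 1; split; [exact: num_real|move=> M M1 u /= ->; exact: ltW].
  rewrite (_ : U = Num.norm @^-1` [set 1 : R^o]) //.
  apply: closed_comp => [u _|]; first exact: norm_continuous.
  exact: closed_eq.
have zcl : closure (~` K) z by rewrite closure_setC.
have FF := within_nbhs_proper zcl.
have FU : (N @ within (~` K) (nbhs z)) U.
  by rewrite /= /nbhs /= /within /=; apply: filterE => x /N1.
have [u [Uu clu]] : exists u : 'rV[R]_n,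
    U u /\ cluster (N @ within (~` K) (nbhs z)) u := cU _ (fmap_proper_filter N FF) FU.
exists u => [|y Ky]; first by rewrite -normr_eq0 Uu oner_eq0.
rewrite leNgt; apply/negP => d0; set d := dot u _ in d0.
(* Half of the excess [d] is kept by a nearby normal, and the other half absorbs
   the error [dot u' (x - z) <= n |x - z|]. *)
pose e := d / 2 / (n%:R + 1).
have n0 : 0 < n%:R + 1 :> R by rewrite ltr_wpDl.
have e0 : 0 < e by rewrite !divr_gt0.
have HA : (N @ within (~` K) (nbhs z))
    [set u' | exists x, [/\ ~ K x, `|x - z| < e & u' = N x]].
  suff : nbhs z [set x | ~ K x -> exists x', [/\ ~ K x', `|x' - z| < e &
    N x = N x']] by [].
  apply/nbhs_ballP; exists e => //= x.
  by rewrite -ball_normE /= distrC => xz Kx; exists x.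
have HB : nbhs u [set u' | d / 2 < dot u' (y - z)].
  have h : d / 2 < dot (y - z) u by rewrite dotC -/d; lra.
  have H := @cvgr_gt _ _ _ (nbhs_filter u) (dot (y - z)) _ (@dot_continuous (y - z) u) _ h.
  by apply: (filterS _ H) => w /=; rewrite dotC.
have [_ [[x [Kx xz ->]] /= h]] := clu _ _ HA HB.
have := Nle x y Kx Ky.
have -> : y - x = (y - z) - (x - z) by apply/rowP => i; rewrite !mxE; ring.
rewrite dotDr dotNr; have := dot_le (N x) (x - z).
rewrite N1 // mulr1 ler_norml => /andP[_ h1] h2.
have h3 : n%:R * `|x - z| <= n%:R * e by rewrite ler_wpM2l // ltW.
have h4 : (n%:R + 1) * e = d / 2 by rewrite /e mulrC mulfVK // gt_eqF.
lra.
Qed.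

Lemma support_not_interior K c z :
  c != 0 -> (forall y, K y -> dot c (y - z) <= 0) -> ~ K° z.
Proof.
move=> c0 H /interiorP[e e0 He].
pose t := e / 2 / (`|c|).
have cn : 0 < `|c| by rewrite normr_gt0.
have t0 : 0 < t by rewrite !divr_gt0.
have : K (z + t *: c).
  apply: He; rewrite addrC addKr normrZ gtr0_norm // /t mulfVK ?gt_eqF //; lra.
move/H; rewrite addrC addKr dotZr leNgt pmulr_rgt0 // dot_gt0 //.
Qed.

End Geometry.

(** * Convex hulls, polytopes and coproducts *)

Section Hulls.
Context {R : realType} {n : nat}.
Implicit Types (x y z : 'rV[R]_n) (A K : set 'rV[R]_n).

Lemma conv_hull_convex A : @convex_set R 'rV[R]_n (conv_hull A).
Proof.
apply/convexP => x y t Ax Ay t01 K [cK AK].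
by move/convexP: (cK); apply=> //; [apply: Ax|apply: Ay].
Qed.

Lemma conv_hull_sub A K : @convex_set R 'rV[R]_n K -> A `<=` K -> conv_hull A `<=` K.
Proof. exact: smallest_sub. Qed.

Lemma sub_conv_hull A : A `<=` conv_hull A.
Proof. exact: sub_gen_smallest. Qed.

Lemma conv_hull_mono A K : A `<=` K -> conv_hull A `<=` conv_hull K.
Proof.
move=> AK; apply: conv_hull_sub; first exact: conv_hull_convex.
exact: subset_trans AK (@sub_conv_hull _).
Qed.

(** The cone over [K] with apex [x]; for convex nonempty [K] it is the convex hull
    of [x] and [K], in a form where compactness and convexity are immediate. *)
Definition cone_over x K : set 'rV[R]_n :=
  [set z | exists t y, [/\ 0 <= t <= 1, K y & z = t *: x + (1 - t) *: y]].

Lemma cone_over_convex x K :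
  @convex_set R 'rV[R]_n K -> @convex_set R 'rV[R]_n (cone_over x K).
Proof.
move=> /convexP cK; apply/convexP => _ _ l [t [y [t01 Ky ->]]] [s [z [s01 Kz ->]]].
move=> l01; pose r := l * t + (1 - l) * s.
have r01 : 0 <= r <= 1 by rewrite /r; nra.
have [r1|r1] := eqVneq r 1.
  exists 1, y; split=> //; first by rewrite ler01 lexx.
  have h : 0 <= l * (1 - t) by apply: mulr_ge0; lra.
  have h' : 0 <= (1 - l) * (1 - s) by apply: mulr_ge0; lra.
  have e1 : l * (1 - t) = 0 by rewrite /r in r1; lra.
  have e2 : (1 - l) * (1 - s) = 0 by rewrite /r in r1; lra.
  rewrite !scalerDr !scalerA e1 e2 !scale0r !addr0 -scalerDl -/r r1.
  by rewrite subrr scale0r addr0.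
exists r, ((l * (1 - t) / (1 - r)) *: y + (1 - l * (1 - t) / (1 - r)) *: z).
have r1' : 0 < 1 - r by lra.
have e : 1 - r = l * (1 - t) + (1 - l) * (1 - s) by rewrite /r; ring.
have h : 0 <= l * (1 - t) by apply: mulr_ge0; lra.
have h' : 0 <= (1 - l) * (1 - s) by apply: mulr_ge0; lra.
split=> //.
  apply: cK => //; rewrite divr_ge0 ?(ltW r1') //=.
  by rewrite ler_pdivrMr // mul1r e lerDl.
apply/rowP => i; rewrite !mxE /r; field.
by rewrite /r in r1'; rewrite gt_eqF.
Qed.

Lemma conv_hullU1 x K : @convex_set R 'rV[R]_n K -> K !=set0 ->
  conv_hull (x |` K) = cone_over x K.
Proof.
move=> cK [k Kk]; apply/seteqP; split.
  apply: conv_hull_sub; first exact: cone_over_convex.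
  move=> y [->|Ky].
    by exists 1, k; split=> //; [rewrite ler01 lexx|rewrite subrr scale0r addr0 scale1r].
  by exists 0, y; split=> //; [rewrite ler01 lexx|rewrite subr0 scale0r add0r scale1r].
move=> _ [t [y [t01 Ky ->]]].
have /convexP := @conv_hull_convex (x |` K); apply=> //.
  by apply: sub_conv_hull; left.
by apply: sub_conv_hull; right.
Qed.

Lemma cone_over_compact x K : compact K -> compact (cone_over x K).
Proof.
move=> cK.
have -> : cone_over x K =
   (fun p : R^o * 'rV[R]_n => p.1 *: x + (1 - p.1) *: p.2) @` (`[0, 1] `*` K).
  apply/seteqP; split.
    move=> _ [t [y [t01 Ky ->]]]; by exists (t, y).
  by move=> _ [[t y] [/= t01 Ky] <-]; exists t, y.
apply: continuous_compact; last first.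
  by apply: compact_setX => //; exact: segment_compact.
apply/continuous_subspaceT => p.
apply: cvgD.
  by apply: cvgZr_tmp; exact: cvg_fst.
apply: cvgZ; last exact: cvg_snd.
apply: cvgB; first exact: cvg_cst.
exact: cvg_fst.
Qed.

(** Adding the vertices one at a time, each hull is a cone over the previous
    one. *)
Lemma polytope_compact K : polytope K -> compact K.
Proof.
move=> [V /finite_seqP[s ->] ->].
elim: s => [|x s IH].
  rewrite (_ : conv_hull _ = set0); first exact: compact0.
  by rewrite -subset0; apply: conv_hull_sub => [|y] //.
rewrite (_ : [set` x :: s] = x |` [set` s]); last first.
  apply/seteqP; split=> y /=; rewrite inE.
    by case/orP => [/eqP|]; [left|right].
  by case=> [->|->]; rewrite ?eqxx ?orbT.
have [s0|s0] := pselect ([set` s] !=set0); last first.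
  rewrite (_ : conv_hull _ = [set x]); first exact: compact_set1.
  apply/seteqP; split.
    apply: conv_hull_sub => [|y [//|sy]].
      by apply/convexP => _ _ t -> -> _; rewrite -scalerDl addrC subrK scale1r.
    by case: s0; exists y.
  by move=> _ ->; apply: sub_conv_hull; left.
rewrite (_ : conv_hull _ = conv_hull (x |` conv_hull [set` s])).
  rewrite conv_hullU1; first exact: cone_over_compact.
    exact: conv_hull_convex.
  by have [y sy] := s0; exists y; exact: sub_conv_hull.
apply/seteqP; split.
  by apply: conv_hull_mono => y [->|sy]; [left|right; exact: sub_conv_hull].
apply: conv_hull_sub; first exact: conv_hull_convex.
move=> y [->|]; first by apply: sub_conv_hull; left.
by apply: conv_hull_mono => z; right.
Qed.

Lemma compact_closed_rV K : compact K -> closed K.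
Proof. by apply: compact_closed; exact: norm_hausdorff. Qed.

Lemma polytope_convex K : polytope K -> @convex_set R 'rV[R]_n K.
Proof. by move=> [V _ ->]; exact: conv_hull_convex. Qed.

Lemma full_dimensionalS A K : A `<=` K -> full_dimensional A -> full_dimensional K.
Proof.
move=> AK fA; apply/seteqP; split=> // x _.
have : affine_hull A x by rewrite fA.
move=> [k [c [a [Aa c1 ->]]]]; exists k, c, a; split=> // i; exact: AK.
Qed.

End Hulls.

Section Coproduct.
Context {R : realType} {n1 n2 : nat}.
Variables (K1 : set 'rV[R]_n1) (K2 : set 'rV[R]_n2).

(** Since both sets contain [0], the right-hand side contains the two generating
    sets; it is convex because nonnegative combinations within a convex set
    containing [0] can be collected into one scaled point. *)
Lemma coproductE :
  @convex_set R 'rV[R]_n1 K1 -> @convex_set R 'rV[R]_n2 K2 -> K1 0 -> K2 0 ->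
  coproduct K1 K2 = [set z | exists t x y, [/\ 0 <= t <= 1, K1 x, K2 y &
     z = row_mx ((1 - t) *: x) (t *: y)]].
Proof.
move=> /convexP c1 /convexP c2 K10 K20; apply/seteqP; split; last first.
  move=> _ [t [x [y [t01 K1x K2y ->]]]].
  have -> : row_mx ((1 - t) *: x) (t *: y) =
      t *: row_mx 0 y + (1 - t) *: row_mx x 0.
    by rewrite !scale_row_mx add_row_mx !scaler0 addr0 add0r.
  have /convexP := @conv_hull_convex _ _ ([set row_mx x (0 : 'rV[R]_n2) | x in K1] `|`
             [set row_mx (0 : 'rV[R]_n1) y | y in K2]).
  by apply=> //; apply: sub_conv_hull; [right; exists y|left; exists x].
apply: conv_hull_sub; last first.
  move=> _ [[x K1x <-]|[y K2y <-]].
    exists 0, x, 0; split=> //; first by rewrite lexx ler01.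
    by rewrite scaler0 subr0 scale1r.
  exists 1, 0, y; split=> //; first by rewrite lexx ler01.
  by rewrite scaler0 scale1r.
have comb m (K : set 'rV[R]_m) a b u v : K 0 ->
    (forall x y t, K x -> K y -> 0 <= t <= 1 -> K (t *: x + (1 - t) *: y)) ->
    0 <= a -> 0 <= b -> K u -> K v -> exists2 w, K w & a *: u + b *: v = (a + b) *: w.
  move=> K0 cK a0 b0 Ku Kv; have [ab|ab] := eqVneq (a + b) 0.
    have a00 : a = 0 by lra.
    have b00 : b = 0 by lra.
    by exists 0 => //; rewrite a00 b00 !scale0r !addr0 scale0r.
  have ab0 : 0 < a + b by rewrite lt_def ab addr_ge0.
  exists ((a / (a + b)) *: u + (1 - a / (a + b)) *: v).
    by apply: cK => //; rewrite divr_ge0 ?(ltW ab0) //= ler_pdivrMr // mul1r lerDl.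
  by apply/rowP => i; rewrite !mxE; field.
apply/convexP => _ _ l [t [x [y [t01 K1x K2y ->]]]] [s [x' [y' [s01 K1x' K2y' ->]]]] l01.
have [w1 Kw1 e1] : exists2 w, K1 w & (l * (1 - t)) *: x + ((1 - l) * (1 - s)) *: x'
    = (l * (1 - t) + (1 - l) * (1 - s)) *: w.
  by apply: comb => //; apply: mulr_ge0; lra.
have [w2 Kw2 e2] : exists2 w, K2 w & (l * t) *: y + ((1 - l) * s) *: y'
    = (l * t + (1 - l) * s) *: w.
  by apply: comb => //; apply: mulr_ge0; lra.
exists (l * t + (1 - l) * s), w1, w2; split=> //; first by nra.
rewrite !scale_row_mx add_row_mx !scalerA e1 e2; congr row_mx; congr (_ *: _).
by ring.
Qed.

Lemma coproduct_polytope :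
  polytope K1 -> polytope K2 -> polytope (coproduct K1 K2).
Proof.
move=> [V1 f1 ->] [V2 f2 ->].
exists ([set row_mx x (0 : 'rV[R]_n2) | x in V1] `|`
        [set row_mx (0 : 'rV[R]_n1) y | y in V2]).
  by rewrite finite_setU; split; exact: finite_image.
apply/seteqP; split; last first.
  apply: conv_hull_mono => _ [[x Vx <-]|[y Vy <-]]; [left|right].
    by exists x => //; exact: sub_conv_hull.
  by exists y => //; exact: sub_conv_hull.
apply: conv_hull_sub; first exact: conv_hull_convex.
set W := (X in _ `<=` conv_hull X).
have /convexP cW := @conv_hull_convex _ _ W.
move=> _ [[x Vx <-]|[y Vy <-]].
  suff H : conv_hull V1 `<=` [set x | conv_hull W (row_mx x 0)].
    exact: (H _ Vx).
  apply: conv_hull_sub => [|z Vz].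
    apply/convexP => u v t /= Wu Wv t01.
    by have := cW _ _ t Wu Wv t01; rewrite !scale_row_mx add_row_mx !scaler0 addr0.
  by apply: sub_conv_hull; left; exists z.
suff H : conv_hull V2 `<=` [set y | conv_hull W (row_mx 0 y)].
    exact: (H _ Vy).
apply: conv_hull_sub => [|z Vz].
  apply/convexP => u v t /= Wu Wv t01.
  by have := cW _ _ t Wu Wv t01; rewrite !scale_row_mx add_row_mx !scaler0 addr0.
by apply: sub_conv_hull; right; exists z.
Qed.

(** Concatenate affine combinations for the two components and correct the
    total weight [2] to [1] by subtracting the origin, a point of the
    coproduct. *)
Lemma coproduct_full_dimensional : K1 0 -> K2 0 ->
  full_dimensional K1 -> full_dimensional K2 ->
  full_dimensional (coproduct K1 K2).
Proof.
move=> K10 K20 f1 f2; apply/seteqP; split=> // z _.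
rewrite -(hsubmxK z).
have : affine_hull K1 (lsubmx z) by rewrite f1.
move=> [k [c [a [Ka c1 ->]]]].
have : affine_hull K2 (rsubmx z) by rewrite f2.
move=> [l [d [b [Kb d1 ->]]]].
pose w (i : 'I_(k + l + 1)) : R := match fintype.split i with
  | inl j => match fintype.split j with inl i => c i | inr i => d i end
  | inr _ => -1 end.
pose p (i : 'I_(k + l + 1)) : 'rV[R]_(n1 + n2) := match fintype.split i with
  | inl j => match fintype.split j with inl i => row_mx (a i) 0 | inr i => row_mx 0 (b i) end
  | inr _ => 0 end.
have sl m m' i : fintype.split (lshift m' i) = inl i :> 'I_m + 'I_m'.
  exact: (unsplitK (inl _ i)).
have sr m m' i : fintype.split (rshift m i) = inr i :> 'I_m + 'I_m'.
  exact: (unsplitK (inr _ i)).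
exists (k + l + 1)%N, w, p; split.
- move=> i; rewrite /p; apply: sub_conv_hull; case: splitP => j _; last first.
    by left; exists 0; rewrite ?row_mx0.
  by case: splitP => i' _; [left; exists (a i')|right; exists (b i')].
- rewrite !big_split_ord /= big_ord1 /w.
  under eq_bigr do rewrite !sl.
  under [X in _ + X + _]eq_bigr do rewrite sl sr.
  by rewrite sr c1 d1; ring.
rewrite !big_split_ord /= big_ord1 /w /p.
under [X in _ = X + _ + _]eq_bigr do rewrite !sl.
under [X in _ = _ + X + _]eq_bigr do rewrite !sl !sr.
rewrite !sr scaler0 addr0.
under [X in _ = X + _]eq_bigr do rewrite scale_row_mx scaler0.
under [X in _ = _ + X]eq_bigr do rewrite scale_row_mx scaler0.
have suml (I : finType) (F : I -> 'rV[R]_n1) :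
   \sum_i row_mx (F i) (0 : 'rV[R]_n2) = row_mx (\sum_i F i) 0.
  elim/big_rec2 : _ => [|i y1 y2 _ ->]; first by rewrite row_mx0.
  by rewrite add_row_mx addr0.
have sumr (I : finType) (F : I -> 'rV[R]_n2) :
   \sum_i row_mx (0 : 'rV[R]_n1) (F i) = row_mx 0 (\sum_i F i).
  elim/big_rec2 : _ => [|i y1 y2 _ ->]; first by rewrite row_mx0.
  by rewrite add_row_mx addr0.
by rewrite suml sumr add_row_mx addr0 add0r.
Qed.

End Coproduct.

Lemma scaled_prod_affine_lattice (R : realType) (n1 n2 : nat)
    (L1 : set 'rV[R]_n1) (L2 : set 'rV[R]_n2) (mu : R) :
  0 < mu -> mu < 1 -> affine_lattice L1 -> affine_lattice L2 ->
  affine_lattice (scaled_prod mu L1 L2).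
Proof.
move=> m0 m1 [t1 [_ [[A1 uA1 ->] ->]]] [t2 [_ [[A2 uA2 ->] ->]]].
pose A := block_mx ((1 - mu) *: A1) 0 0 (mu *: A2).
exists (row_mx ((1 - mu) *: t1) (mu *: t2)),
  [set map_mx (intr : int -> R) z *m A | z in [set: 'rV[int]_(n1 + n2)]].
split.
  exists A => //; rewrite unitmxE det_ublock !detZ !unitrM.
  by rewrite -!unitmxE uA1 uA2 !unitrX // unitfE ?gt_eqF // subr_gt0.
have mapr (x : 'rV[int]_n1) (y : 'rV[int]_n2) :
   map_mx (intr : int -> R) (row_mx x y) = row_mx (map_mx intr x) (map_mx intr y).
  by rewrite map_row_mx.
apply/seteqP; split.
  move=> _ [_ [_ [[_ [x _ <-] <-] [_ [y _ <-] <-] ->]]].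
  exists (row_mx (map_mx intr x *m ((1 - mu) *: A1)) (map_mx intr y *m (mu *: A2))).
    exists (row_mx x y) => //.
    by rewrite mapr mul_row_block !mulmx0 addr0 add0r.
  by rewrite add_row_mx !scalerDr -!scalemxAr.
move=> _ [_ [z _ <-] <-].
exists (t1 + map_mx intr (lsubmx z) *m A1), (t2 + map_mx intr (rsubmx z) *m A2).
split.
- by exists (map_mx intr (lsubmx z) *m A1) => //; exists (lsubmx z).
- by exists (map_mx intr (rsubmx z) *m A2) => //; exists (rsubmx z).
rewrite -{1}(hsubmxK z) mapr mul_row_block !mulmx0 addr0 add0r.
by rewrite add_row_mx !scalerDr -!scalemxAr.
Qed.

(** * Lattice points and lattice-freeness of the coproduct *)

Lemma dot_row_mx (R : realType) (n1 n2 : nat) (a x : 'rV[R]_n1) (b y : 'rV[R]_n2) :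
  dot (row_mx a b) (row_mx x y) = dot a x + dot b y.
Proof. by rewrite /dot tr_row_mx mul_row_col mxE. Qed.

(** Assertion (a) on interiors: supports of the factors at [x1] and [x2] glue to
    a support of the coproduct at [((1 - mu) x1, mu x2)]. *)
Lemma coproduct_lattice_free_interior (R : realType) (n1 n2 : nat)
    (L1 K1 : set 'rV[R]_n1) (L2 K2 : set 'rV[R]_n2) (mu : R) :
  compact K1 -> compact K2 ->
  @convex_set R 'rV[R]_n1 K1 -> @convex_set R 'rV[R]_n2 K2 -> K1 0 -> K2 0 ->
  0 < mu -> mu < 1 -> K1° `&` L1 = set0 -> K2° `&` L2 = set0 ->
  (coproduct K1 K2)° `&` scaled_prod mu L1 L2 = set0.
Proof.
move=> cK1 cK2 vK1 vK2 K10 K20 m0 m1 f1 f2.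
rewrite -subset0 => z [Iz [x1 [x2 [Lx1 Lx2 ez]]]]; move: Iz; rewrite ez => {z ez}.
have [c1 c1n H1] : exists2 c, c != 0 & forall y, K1 y -> dot c (y - x1) <= 0.
  apply: supporting_hyperplane => //; first by exists 0.
  by move=> h; rewrite -[False]/(set0 x1) -f1.
have [c2 c2n H2] : exists2 c, c != 0 & forall y, K2 y -> dot c (y - x2) <= 0.
  apply: supporting_hyperplane => //; first by exists 0.
  by move=> h; rewrite -[False]/(set0 x2) -f2.
pose g1 := dot c1 x1; pose g2 := dot c2 x2.
have {}H1 y : K1 y -> dot c1 y <= g1.
  by move/H1; rewrite dotDr dotNr subr_le0.
have {}H2 y : K2 y -> dot c2 y <= g2.
  by move/H2; rewrite dotDr dotNr subr_le0.
have g10 : 0 <= g1 by rewrite -(dot0r c1) H1.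
have g20 : 0 <= g2 by rewrite -(dot0r c2) H2.
have row0 (a : 'rV[R]_n1) (b : 'rV[R]_n2) : (a != 0) || (b != 0) -> row_mx a b != 0.
  by apply: contraTneq => /eqP; rewrite row_mx_eq0 => /andP[/eqP -> /eqP ->]; rewrite !eqxx.
suff [c cn H] : exists2 c, c != 0 & forall y, coproduct K1 K2 y ->
   dot c (y - row_mx ((1 - mu) *: x1) (mu *: x2)) <= 0.
  exact: (support_not_interior cn H).
have [g1z|g1n] := eqVneq g1 0.
  exists (row_mx c1 0); first by rewrite row0 // c1n.
  rewrite coproductE // => _ [t [y1 [y2 [t01 Ky1 _ ->]]]].
  rewrite dotDr dotNr !dot_row_mx !dotB -/g1 g1z; have := H1 _ Ky1.
  rewrite g1z => h; have : (1 - t) * dot c1 y1 <= 0 by apply: mulr_ge0_le0 => //; lra.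
  by lra.
have [g2z|g2n] := eqVneq g2 0.
  exists (row_mx 0 c2); first by rewrite row0 // c2n orbT.
  rewrite coproductE // => _ [t [y1 [y2 [t01 _ Ky2 ->]]]].
  rewrite dotDr dotNr !dot_row_mx !dotB -/g2 g2z; have := H2 _ Ky2.
  rewrite g2z => h; have : t * dot c2 y2 <= 0 by apply: mulr_ge0_le0 => //; lra.
  by lra.
have p1 : 0 < g1 by rewrite lt_def g1n.
have p2 : 0 < g2 by rewrite lt_def g2n.
exists (row_mx (g1^-1 *: c1) (g2^-1 *: c2)).
  by rewrite row0 // scaler_eq0 invr_eq0 (negbTE g1n) c1n.
rewrite coproductE // => _ [t [y1 [y2 [t01 Ky1 Ky2 ->]]]].
rewrite dotDr dotNr !dot_row_mx !dotB -/g1 -/g2.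
have h1 : g1^-1 * dot c1 y1 <= 1 by rewrite mulrC ler_pdivrMr // mul1r H1.
have h2 : g2^-1 * dot c2 y2 <= 1 by rewrite mulrC ler_pdivrMr // mul1r H2.
have e1 : g1^-1 * ((1 - mu) * g1) = 1 - mu by field.
rewrite e1 mulVf // mulr1.
have : (1 - t) * (g1^-1 * dot c1 y1) <= (1 - t) * 1 by apply: ler_wpM2l => //; lra.
have : t * (g2^-1 * dot c2 y2) <= t * 1 by apply: ler_wpM2l => //; lra.
lra.
Qed.

Section LatticeFacts.
Context {R : realType} {n : nat}.
Implicit Types (L : set 'rV[R]_n) (x u v : 'rV[R]_n).

Lemma norm_mulmx_le (A : 'M[R]_n) : exists2 C, 0 < C &
  forall v, `|v *m A| <= C * `|v|.
Proof.
exists (n%:R * `|A| + 1); first by rewrite ltr_wpDl // mulr_ge0.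
move=> v; apply: norm_le_coord; first by rewrite mulr_ge0 // addr_ge0 // mulr_ge0.
move=> j; rewrite mxE; apply: le_trans (ler_norm_sum _ _ _) _.
apply: (@le_trans _ _ (\sum_(i < n) `|A| * `|v|)).
  apply: ler_sum => i _; rewrite normrM mulrC ler_pM ?coord_le_norm //.
  rewrite [leRHS]/Num.norm /= mx_normrE; apply/bigmax_geP; right.
  by exists (i, j).
by rewrite sumr_const card_ord -[(_ * _) *+ n]mulr_natl mulrA ler_wpM2r // lerDl.
Qed.

(** Coordinates with respect to a lattice basis are controlled by the norm;
    discreteness and finiteness in bounded sets both follow. *)
Lemma lattice_coord_bound L : lattice L -> exists2 C, 0 < C &
  exists2 A : 'M[R]_n, L = [set map_mx (intr : int -> R) z *m A | z in [set: 'rV[int]_n]] &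
  forall (z : 'rV[int]_n) j, `|(z 0 j)%:~R : R| <= C * `|map_mx (intr : int -> R) z *m A|.
Proof.
move=> [A uA ->]; have [C C0 HC] := norm_mulmx_le (invmx A).
exists C => //; exists A => // z j.
have := HC (map_mx intr z *m A); rewrite mulmxK // => h.
by apply: le_trans h; have := coord_le_norm (map_mx (intr : int -> R) z) j; rewrite mxE.
Qed.

Lemma lattice_discrete L : lattice L -> exists2 e, 0 < e &
  forall u, L u -> `|u| < e -> u = 0.
Proof.
move=> /lattice_coord_bound[C C0 [A -> H]].
exists C^-1; first by rewrite invr_gt0.
move=> _ [z _ <-]; rewrite -[C^-1]mul1r ltr_pdivlMr // mulrC => h.
suff -> : z = 0 by rewrite map_mx0 mul0mx.
apply/rowP => j; rewrite mxE.
have := le_lt_trans (H z j) h; rewrite -intr_norm ltrz1; lia.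
Qed.

Lemma finite_int_box (N : nat) :
  finite_set [set z : 'rV[int]_n | forall j, `|z 0 j| <= N%:Z].
Proof.
pose f (w : 'rV['I_(N + N).+1]_n) : 'rV[int]_n :=
  \row_j ((w 0 j : nat)%:Z - N%:Z).
apply: (@sub_finite_set _ _ (f @` setT)); last first.
  by apply: finite_image; exact: finite_finset.
move=> z /= Hz.
have h j : (absz (z 0%R j + N%:Z)%R < (N + N).+1)%N by have := Hz j; lia.
exists (\row_j Ordinal (h j)) => //; apply/rowP => j; rewrite !mxE /=.
by have := Hz j; lia.
Qed.

Lemma affine_lattice_finite L M : affine_lattice L ->
  finite_set [set x | L x /\ `|x| <= M].
Proof.
move=> [t [L0 [/lattice_coord_bound[C C0 [A -> H]] ->]]].
pose N := Num.bound (C * (M + `|t|)).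
apply: (@sub_finite_set _ _ ((fun z => t + map_mx (intr : int -> R) z *m A) @`
   [set z : 'rV[int]_n | forall j, `|z 0 j| <= N%:Z])); last first.
  by apply: finite_image; exact: finite_int_box.
move=> _ [[_ [z _ <-] <-] hM]; exists z => //= j.
rewrite -(ler_int R) intr_norm; apply: le_trans (H z j) _.
apply: ltW; apply: le_lt_trans (archi_boundP _) => //; last first.
  by rewrite mulr_ge0 ?(ltW C0) // addr_ge0 // (le_trans _ hM).
rewrite ler_pM2l //.
have {1}-> : map_mx (intr : int -> R) z *m A = (t + map_mx intr z *m A) - t by rewrite addrC addKr.
by apply: le_trans (ler_normB _ _) _; rewrite lerD2r.
Qed.

End LatticeFacts.

(** * Facets of a maximal lattice-free body *)

Section Facets.
Context {R : realType} {n : nat}.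
Implicit Types (L B K : set 'rV[R]_n) (S : seq ('rV[R]_n * 'rV[R]_n)).
Implicit Types (x y z c : 'rV[R]_n).

(** The pair [p] stands for the half-space with outer normal [p.1] whose boundary
    passes through [p.2]. *)
Definition polyhedron S : set 'rV[R]_n :=
  [set y | forall p, p \in S -> dot p.1 (y - p.2) <= 0].

Lemma polyhedron_strict S z :
  (forall p, p \in S -> dot p.1 (z - p.2) < 0) -> (polyhedron S)° z.
Proof.
elim: S => [|p S IH] H.
  by apply/interiorP; exists 1.
have /interiorP[e e0 He] : (polyhedron S)° z.
  by apply: IH => q qS; apply: H; rewrite inE qS orbT.
have := H p; rewrite inE eqxx => /(_ isT) Hp.
pose C := n%:R * `|p.1| + 1.
have C0 : 0 < C by rewrite ltr_wpDl // mulr_ge0.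
pose d := - dot p.1 (z - p.2) / C.
have d0 : 0 < d by rewrite divr_gt0 // oppr_gt0.
apply/interiorP; exists (Num.min e d); first by rewrite lt_min e0.
move=> y; rewrite lt_min => /andP[ye yd] q; rewrite inE => /orP[/eqP ->|]; last exact: He.
have -> : y - p.2 = (y - z) + (z - p.2) by apply/rowP => i; rewrite !mxE; ring.
rewrite dotDr; have := dot_le p.1 (y - z); rewrite ler_norml => /andP[_ h].
have h2 : C * `|y - z| <= C * d by rewrite ler_wpM2l // ltW.
have h3 : C * d = - dot p.1 (z - p.2) by rewrite /d mulrC mulfVK // gt_eqF.
have h4 : 0 <= `|y - z| by [].
rewrite h3 /C mulrDl mul1r in h2; lra.
Qed.

Lemma lattice_free_nonempty L B : lattice_free L B -> B !=set0.
Proof.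
move=> [fB _ _ _]; apply/set0P; apply/eqP => B0.
have : affine_hull B 0 by rewrite fB.
move=> [[|k] [c [a [Ba c1 _]]]].
  by move/eqP: c1; rewrite big_ord0 eq_sym oner_eq0.
by have := Ba ord0; rewrite B0.
Qed.

Lemma affine_lattice_nonempty L : affine_lattice L -> L !=set0.
Proof.
move=> [t [_ [[A _ ->] ->]]]; exists (t + map_mx (intr : int -> R) 0 *m A).
by exists (map_mx (intr : int -> R) 0 *m A) => //; exists 0.
Qed.

Lemma finite_separation B (D : seq 'rV[R]_n) : closed B ->
  (forall y, y \in D -> ~ B y) ->
  exists2 d, 0 < d & forall y b, y \in D -> B b -> d <= `|y - b|.
Proof.
move=> clB; elim: D => [|x D IH] HD; first by exists 1.
have [|d d0 Hd] := IH; first by move=> y yD; apply: HD; rewrite inE yD orbT.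
have : (~` B)° x.
  have := closed_openC clB; rewrite openE; apply.
  by apply: HD; rewrite inE eqxx.
move=> /interiorP[e e0 He]; exists (Num.min d e); first by rewrite lt_min d0.
move=> y b; rewrite inE => /orP[/eqP ->|yD] Bb; rewrite ge_min.
  apply/orP; right; rewrite leNgt; apply/negP => h; apply: (He b) => //.
  by rewrite distrC.
by rewrite Hd.
Qed.

(** Maximality makes every outside point see a lattice point of [B].  Let [b] be
    the point of [B] nearest to [x].  Only finitely many lattice points lie near
    [B] but outside it, and they keep a positive distance from it; so the cone
    over a point close enough to [b] on the segment towards [x] meets the lattice
    only in [B].  By maximality its interior does contain a lattice point. *)
Lemma visible_lattice_point L B x : affine_lattice L -> compact B ->
  maximal_lattice_free L B -> ~ B x ->
  exists b e z, [/\ B b, 0 < e <= 1, L z, B z &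
    (cone_over (e *: x + (1 - e) *: b) B)° z].
Proof.
move=> aL cB [lfB maxB] Bx.
have [fB clB vB freeB] := lfB.
have B0 := lattice_free_nonempty lfB.
have [b Bb bn] := nearest_point x cB vB B0.
have [M [_ HM]] := compact_bounded cB.
have {}HM y : B y -> `|y| <= M + 1 by move=> By; apply: (HM (M + 1)) => //; rewrite ltrDl.
have [D HD] : exists D : seq 'rV[R]_n, forall y, y \in D <-> [/\ L y, `|y| <= M + 2 & ~ B y].
  have : finite_set ([set y | L y /\ `|y| <= M + 2] `\` B).
    exact/finite_setD/affine_lattice_finite.
  move=> /finite_seqP[s es]; exists s => y.
  have -> : (y \in s) <-> [set` s] y by [].
  rewrite -es; split; first by move=> [[]].
  by move=> [].
have [d d0 Hd] := finite_separation clB (fun y yD => let: And3 _ _ h := (HD y).1 yD in h).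
have xb : x - b != 0 by rewrite subr_eq0; apply: contra_not_neq Bx => ->.
have nxb : 0 < `|x - b| by rewrite normr_gt0.
pose r := Num.min d 1.
have r0 : 0 < r by rewrite lt_min d0 ltr01.
(* This choice makes [e |x - b| < r], so every point of the cone is within [r]
   of [B]. *)
pose e := r / (r + `|x - b|).
have rx : 0 < r + `|x - b| by rewrite addr_gt0.
have e0 : 0 < e by rewrite divr_gt0.
have e1 : e <= 1 by rewrite ler_pdivrMr // mul1r lerDl ltW.
have ex : e * `|x - b| < r.
  have : e * (r + `|x - b|) = r by rewrite /e mulfVK // gt_eqF.
  by have : 0 < e * r by [rewrite mulr_gt0]; lra.
pose x' := e *: x + (1 - e) *: b.
pose K := cone_over x' B.
have BK : B `<=` K.
  move=> y By; exists 0, y; split=> //; first by rewrite lexx ler01.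
  by rewrite scale0r add0r subr0 scale1r.
have Kx' : K x'.
  exists 1, b; split=> //; first by rewrite lexx ler01.
  by rewrite subrr scale0r scale1r addr0.
have cK : compact K by exact: cone_over_compact.
have Bx' : ~ B x'.
  move=> /bn; have -> : x' - b = e *: (x - b) by apply/rowP => i; rewrite !mxE; ring.
  by rewrite dotZr leNgt pmulr_rgt0 // dot_gt0.
have : ~ (K° `&` L = set0).
  move=> KL; apply: Bx'; rewrite -(maxB K) //; split=> //.
  - exact: full_dimensionalS BK fB.
  - exact: compact_closed_rV.
  - exact: cone_over_convex.
move/eqP/set0P => [z [Kz Lz]]; exists b, e, z; split=> //; first by rewrite e0.
have [t [y [t01 By zE]]] := interior_subset Kz.
have Bw : B (t *: b + (1 - t) *: y) by move/convexP: vB; apply.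
have zw : `|z - (t *: b + (1 - t) *: y)| < r.
  have -> : z - (t *: b + (1 - t) *: y) = (t * e) *: (x - b).
    by rewrite zE /x'; apply/rowP => i; rewrite !mxE; ring.
  rewrite normrZ ger0_norm; last by case/andP: t01 => ? _; rewrite mulr_ge0 // ltW.
  apply: le_lt_trans ex; rewrite -mulrA ger_pMl; first by case/andP: t01.
  by rewrite mulr_gt0.
apply: contrapT => Bz.
have zD : z \in D.
  apply/HD; split=> //.
  have := ler_normD (z - (t *: b + (1 - t) *: y)) (t *: b + (1 - t) *: y).
  rewrite subrK; have := HM _ Bw; have : r <= 1 by rewrite ge_min lexx orbT.
  lra.
have := Hd z _ zD Bw; have : r <= d by rewrite ge_min lexx.
lra.
Qed.

(** Finitely many lattice points lie in [B], all on its boundary; choose a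
    supporting half-space at each.  An outside point satisfying all of them
    would see a lattice point of [B] in the interior of a cone that still
    satisfies the inequality tight there. *)
Lemma maximal_lattice_free_polyhedron L B : affine_lattice L -> compact B ->
  maximal_lattice_free L B -> exists S, polyhedron S `<=` B /\
  forall p, p \in S -> [/\ p.1 != 0, L p.2, B p.2 & forall y, B y -> dot p.1 (y - p.2) <= 0].
Proof.
move=> aL cB mB; have [[fB clB vB freeB] _] := mB.
have B0 := lattice_free_nonempty mB.1.
have [M [_ HM]] := compact_bounded cB.
have {}HM y : B y -> `|y| <= M + 1 by move=> By; apply: (HM (M + 1)) => //; rewrite ltrDl.
have [s Hs] : exists s : seq 'rV[R]_n, forall y, y \in s <-> L y /\ B y.
  have : finite_set ([set y | L y /\ `|y| <= M + 1] `&` B).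
    exact/finite_setIl/affine_lattice_finite.
  move=> /finite_seqP[s es]; exists s => y.
  have -> : (y \in s) <-> [set` s] y by [].
  rewrite -es; split; first by move=> [[]].
  by move=> [Ly By]; split=> //; split=> //; exact: HM.
have supp z : L z -> exists c, c != 0 /\ forall y, B y -> dot c (y - z) <= 0.
  move=> Lz; have [c c0 Hc] : exists2 c, c != 0 & forall y, B y -> dot c (y - z) <= 0.
    apply: supporting_hyperplane => // Bz.
    by rewrite -[False]/(set0 z) -freeB.
  by exists c.
have /choice[c Hc] z : exists c, L z -> c != 0 /\ forall y, B y -> dot c (y - z) <= 0.
  by have [/supp[c ?]|] := pselect (L z); [exists c|exists 0].
exists [seq (c z, z) | z <- s]; split; last first.
  by move=> _ /mapP[z /Hs[Lz Bz] ->]; have [] := Hc z Lz.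
move=> x Px; apply: contrapT => Bx.
have [b [e [z [Bb e01 Lz Bz]]]] := visible_lattice_point aL cB mB Bx.
have [c0 Hz] := Hc z Lz.
apply: (support_not_interior c0) => _ [t [y [t01 By ->]]].
have Hx : dot (c z) (x - z) <= 0.
  by have := Px (c z, z); apply; apply/mapP; exists z => //; exact/Hs.
have -> : t *: (e *: x + (1 - e) *: b) + (1 - t) *: y - z =
  (t * e) *: (x - z) + (t * (1 - e)) *: (b - z) + (1 - t) *: (y - z).
  by apply/rowP => i; rewrite !mxE; ring.
rewrite !dotDr !dotZr.
have : t * e * dot (c z) (x - z) <= 0 by apply: mulr_ge0_le0 => //; apply: mulr_ge0; lra.
have : t * (1 - e) * dot (c z) (b - z) <= 0 by apply: mulr_ge0_le0; [apply: mulr_ge0; lra|exact: Hz].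
have : (1 - t) * dot (c z) (y - z) <= 0 by apply: mulr_ge0_le0; [lra|exact: Hz].
lra.
Qed.

(** Take a family of half-spaces as above of least size.  Dropping [p] admits an
    outside point [x] that violates [p] only; the lattice point that [x] sees
    satisfies the other inequalities strictly and, being on the boundary, has
    equality in [p].  Near such a point [B] is a half-space, so its normal is
    unique up to a nonnegative factor. *)
Lemma maximal_lattice_free_facets L B : affine_lattice L -> compact B ->
  maximal_lattice_free L B -> exists S, B = polyhedron S /\
  forall p, p \in S -> [/\ p.1 != 0, L p.2, B p.2 &
    forall c, (forall y, B y -> dot c (y - p.2) <= 0) ->
      exists2 s, 0 <= s & c = s *: p.1].
Proof.
move=> aL cB mB; have [[fB clB vB freeB] _] := mB.
pose good k := exists S, [/\ size S = k, polyhedron S `<=` B &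
  forall p, p \in S -> [/\ p.1 != 0, L p.2, B p.2 & forall y, B y -> dot p.1 (y - p.2) <= 0]].
have exg : exists k, `[< good k >].
  have [S [H1 H2]] := maximal_lattice_free_polyhedron aL cB mB.
  by exists (size S); apply/asboolP; exists S.
case: (ex_minnP exg) => k /asboolP[S [Sk SB HS]] kmin.
have BS : B `<=` polyhedron S by move=> y By p /HS[_ _ _]; apply.
have facet p : p \in S -> exists z, [/\ L z, B z, dot p.1 (z - p.2) = 0 &
    forall q, q \in S -> q != p -> dot q.1 (z - q.2) < 0].
  move=> pS; pose S' := [seq q <- S | q != p].
  have : ~ (polyhedron S' `<=` B).
    move=> S'B; have : (k <= size S')%N.
      apply: kmin; apply/asboolP; exists S'; split=> // q.
      by rewrite mem_filter => /andP[_]; exact: HS.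
    rewrite leqNgt -Sk size_filter -(count_predC (predC1 p) S) -[ltnLHS]addn0.
    rewrite ltn_add2l -has_count; apply/negP/negPn/hasP; exists p => //=.
    by rewrite negbK.
  move=> /existsNP[x /not_implyP[S'x Bx]].
  have [b [e [z [Bb e01 Lz Bz Kz]]]] := visible_lattice_point aL cB mB Bx.
  have str q : q \in S -> q != p -> dot q.1 (z - q.2) < 0.
    move=> qS qp; rewrite ltNge; apply/negP => h.
    have [q0 _ _ Hq] := HS q qS.
    apply: (support_not_interior q0 _ Kz) => _ [t [y [t01 By ->]]].
    have S'xq : dot q.1 (x - q.2) <= 0 by apply: S'x; rewrite mem_filter qp.
    have -> : t *: (e *: x + (1 - e) *: b) + (1 - t) *: y - z =
      (t * e) *: (x - q.2) + (t * (1 - e)) *: (b - q.2) + (1 - t) *: (y - q.2) - (z - q.2).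
      by apply/rowP => i; rewrite !mxE; ring.
    rewrite dotDr dotNr; set u := dot q.1 (z - q.2) in h *.
    rewrite !dotDr !dotZr.
    have : t * e * dot q.1 (x - q.2) <= 0 by apply: mulr_ge0_le0 => //; apply: mulr_ge0; lra.
    have : t * (1 - e) * dot q.1 (b - q.2) <= 0 by apply: mulr_ge0_le0; [apply: mulr_ge0; lra|exact: Hq].
    have : (1 - t) * dot q.1 (y - q.2) <= 0 by apply: mulr_ge0_le0; [lra|exact: Hq].
    lra.
  exists z; split=> //; apply/eqP; rewrite eq_le (BS z Bz) //= leNgt; apply/negP => zp.
  have : (polyhedron S)° z.
    apply: polyhedron_strict => q qS; have [->//|qp] := eqVneq q p; exact: str.
  move=> /(interiorS SB) Iz; by rewrite -[False]/(set0 z) -freeB.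
have /choice[w Hw] p : exists z, p \in S -> [/\ L z, B z, dot p.1 (z - p.2) = 0 &
    forall q, q \in S -> q != p -> dot q.1 (z - q.2) < 0].
  by case: (boolP (p \in S)) => [/facet[z Hz]|_]; [exists z|exists 0].
have shift p y : p \in S -> dot p.1 (y - w p) = dot p.1 (y - p.2).
  move=> /Hw[_ _ e _].
  have -> : y - w p = (y - p.2) - (w p - p.2) by apply/rowP => i; rewrite !mxE; ring.
  by rewrite dotDr dotNr e subr0.
exists [seq (p.1, w p) | p <- S]; split.
  apply/seteqP; split.
    by move=> y By _ /mapP[p pS ->] /=; rewrite shift //; exact: BS.
  move=> y Hy; apply: SB => p pS; rewrite -shift //.
  by apply: (Hy (p.1, w p)); apply/mapP; exists p.
move=> _ /mapP[p pS ->] /=; have [p0 _ _ _] := HS p pS.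
have [Lw Bw ew Hs] := Hw p pS; split=> // c Hc.
have dir d : dot p.1 d <= 0 -> dot c d <= 0.
  move=> pd.
  have /interiorP[e e0 He] : (polyhedron [seq q <- S | q != p])° (w p).
    by apply: polyhedron_strict => q; rewrite mem_filter => /andP[qp qS]; exact: Hs.
  pose t := e / (`|d| + 1).
  have d0 : 0 < `|d| + 1 by rewrite ltr_wpDl.
  have t0 : 0 < t by rewrite divr_gt0.
  have : B (w p + t *: d).
    apply: SB => q qS; have [->|qp] := eqVneq q p.
      by rewrite -shift // addrC addKr dotZr mulr_ge0_le0 // ltW.
    apply: He; last by rewrite mem_filter qp.
    rewrite addrC addKr normrZ gtr0_norm // /t -mulrA gtr_pMr //.
    by rewrite mulrC ltr_pdivrMr // mul1r ltrDl.
  by move/Hc; rewrite addrC addKr dotZr pmulr_rle0.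
have pp := dot_gt0 p0.
(* The component [v] of [c] orthogonal to [p.1] is a direction along the facet,
   so [dot c v <= 0], while [dot c v] is the square of [v]. *)
exists (dot c p.1 / dot p.1 p.1).
  rewrite divr_ge0 ?(ltW pp) // -oppr_le0 -dotNr; apply: dir.
  by rewrite dotNr oppr_le0 ltW.
apply/eqP; rewrite -subr_eq0; apply/eqP/dot_eq0.
set v := c - _; apply/eqP; rewrite eq_le dot_ge0 andbT.
have pv : dot p.1 v = 0 by rewrite /v !dotB (dotC p.1 c) divfK ?subrr // gt_eqF.
rewrite {1}/v dotDl dotNl dotZl pv mulr0 subr0; apply: dir; by rewrite pv.
Qed.

End Facets.

(** * Maximality of the coproduct *)

(** The offsets [dot p.1 p.2] are nonnegative because [B] contains [0].  Facets
    through the origin have offset zero and need separate treatment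
    throughout. *)
Section BoundedPolyhedron.
Context {R : realType} {n : nat}.
Variables (L B : set 'rV[R]_n) (S : seq ('rV[R]_n * 'rV[R]_n)).
Hypotheses (aL : affine_lattice L) (cB : compact B) (lfB : lattice_free L B).
Hypotheses (B0 : B 0) (BS : B = polyhedron S).

Let offset_ge0 p : p \in S -> 0 <= dot p.1 p.2.
Proof.
by move=> pS; move: B0; rewrite BS => /(_ p pS); rewrite sub0r dotNr oppr_le0.
Qed.

Let memB y : B y <-> forall p, p \in S -> dot p.1 y <= dot p.1 p.2.
Proof.
by rewrite BS; split=> H p pS; have := H p pS; rewrite dotDr dotNr subr_le0.
Qed.

Lemma no_recession x : (forall p, p \in S -> dot p.1 x <= 0) -> x = 0.
Proof.
move=> Hx; apply: contrapT => /eqP x0.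
have [M [_ HM]] := compact_bounded cB.
have nx : 0 < `|x| by rewrite normr_gt0.
pose t := (`|M| + 2) / `|x|.
have t0 : 0 <= t by rewrite divr_ge0 // addr_ge0.
have /(HM (`|M| + 1)) : B (t *: x).
  apply/memB => p pS; rewrite dotZr (le_trans _ (offset_ge0 pS)) //.
  by rewrite mulr_ge0_le0 // Hx.
rewrite /= normrZ ger0_norm // /t mulfVK ?gt_eqF //.
by move=> /(_ _); have := ler_norm M; lra.
Qed.

(** Otherwise [x] would be a recession direction of the bounded set [B], hence
    zero, and all offsets would vanish.  Then [B] would be a bounded cone, that
    is [{0}], and full-dimensionality would make the space a single point, which
    lies in the lattice and in the interior of [B]. *)
Lemma exists_positive_facet x :
  (forall p, p \in S -> dot p.1 p.2 = 0 -> dot p.1 x <= 0) ->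
  exists p, [/\ p \in S, 0 < dot p.1 p.2 & 0 <= dot p.1 x].
Proof.
move=> Hx; apply: contrapT => /forallNP H.
have neg p : p \in S -> 0 < dot p.1 p.2 -> dot p.1 x < 0.
  by move=> pS p0; rewrite ltNge; apply/negP => h; apply: (H p).
have x0 : x = 0.
  apply: no_recession => p pS; have := offset_ge0 pS; rewrite le_eqVlt => /orP[/eqP e|].
    exact: Hx.
  by move=> /(neg p pS)/ltW.
have b0 p : p \in S -> dot p.1 p.2 = 0.
  move=> pS; apply/eqP; rewrite eq_le offset_ge0 // andbT leNgt.
  by apply/negP => /(neg p pS); rewrite x0 dot0r ltxx.
have Bz y : B y -> y = 0.
  by move=> /memB By; apply: no_recession => p pS; rewrite -(b0 p pS) By.
have all0 (y : 'rV[R]_n) : y = 0.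
  have [fB _ _ _] := lfB; have : affine_hull B y by rewrite fB.
  by move=> [k [c [a [Ba _ ->]]]]; rewrite big1 // => i _; rewrite (Bz _ (Ba i)) scaler0.
have [_ _ _ freeB] := lfB.
have [z Lz] := affine_lattice_nonempty aL.
rewrite -[False]/(set0 z) -freeB; split=> //.
by apply/interiorP; exists 1 => // y _; rewrite (all0 y).
Qed.

(** Membership in [t B] from the scaled inequalities; for [t = 0] this is the
    absence of recession directions. *)
Lemma scaled_mem t x : 0 <= t ->
  (forall p, p \in S -> dot p.1 x <= t * dot p.1 p.2) -> exists2 y, B y & x = t *: y.
Proof.
move=> t0 Hx; have [tz|tn] := eqVneq t 0.
  exists 0 => //; rewrite scaler0; apply: no_recession => p /Hx.
  by rewrite tz mul0r.
have tp : 0 < t by rewrite lt_def tn.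
exists (t^-1 *: x); last by rewrite scalerA mulfV // scale1r.
apply/memB => p pS; rewrite dotZr mulrC ler_pdivrMr //.
by rewrite [leRHS]mulrC Hx.
Qed.

End BoundedPolyhedron.

Section CoproductMaximal.
Context {R : realType} {n1 n2 : nat}.
Variables (L1 B1 : set 'rV[R]_n1) (L2 B2 : set 'rV[R]_n2) (mu : R).
Hypotheses (aL1 : affine_lattice L1) (aL2 : affine_lattice L2).
Hypotheses (pB1 : polytope B1) (pB2 : polytope B2) (B10 : B1 0) (B20 : B2 0).
Hypotheses (mu0 : 0 < mu) (mu1 : mu < 1).

Lemma coproduct_lattice_free : lattice_free L1 B1 -> lattice_free L2 B2 ->
  lattice_free (scaled_prod mu L1 L2) (coproduct B1 B2).
Proof.
move=> [f1 _ v1 i1] [f2 _ v2 i2]; split.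
- exact: coproduct_full_dimensional.
- by apply: compact_closed_rV; apply: polytope_compact; exact: coproduct_polytope.
- exact: conv_hull_convex.
- by apply: coproduct_lattice_free_interior => //; exact: polytope_compact.
Qed.

Hypotheses (m1 : maximal_lattice_free L1 B1) (m2 : maximal_lattice_free L2 B2).

(** A functional supporting the cone over [x] and the coproduct, hence [C], at the
    lattice point of two facets.  Its restrictions to the factors are bounded by
    its maximum and reach it at [p.2] and [q.2], because the weights [1 - mu] and
    [mu] are positive; uniqueness of the normals does the rest.  The last
    inequality says that [x] lies on the right side. *)
Lemma coproduct_facet_support (S1 : seq ('rV[R]_n1 * 'rV[R]_n1))
    (S2 : seq ('rV[R]_n2 * 'rV[R]_n2)) (x : 'rV[R]_(n1 + n2)) C :
  lattice_free (scaled_prod mu L1 L2) C -> coproduct B1 B2 `<=` C -> C x ->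
  (forall p, p \in S1 -> [/\ p.1 != 0, L1 p.2, B1 p.2 &
    forall c, (forall y, B1 y -> dot c (y - p.2) <= 0) ->
      exists2 s, 0 <= s & c = s *: p.1]) ->
  (forall p, p \in S2 -> [/\ p.1 != 0, L2 p.2, B2 p.2 &
    forall c, (forall y, B2 y -> dot c (y - p.2) <= 0) ->
      exists2 s, 0 <= s & c = s *: p.1]) ->
  forall p q, p \in S1 -> q \in S2 -> exists s t,
  [/\ 0 <= s, 0 <= t, (s != 0) || (t != 0),
    s * dot p.1 p.2 = t * dot q.1 q.2 &
    s * dot p.1 (lsubmx x) + t * dot q.1 (rsubmx x) <= s * dot p.1 p.2].
Proof.
move=> [fC clC vC freeC] BC Cx H1 H2 p q /H1[p0 Lp Bp Hp] /H2[q0 Lq Bq Hq].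
have [_ _ v1 _] := m1.1; have [_ _ v2 _] := m2.1.
pose z := row_mx ((1 - mu) *: p.2) (mu *: q.2).
pose K := cone_over x (coproduct B1 B2).
have cpE := coproductE v1 v2 B10 B20.
have cB : compact (coproduct B1 B2) by apply: polytope_compact; exact: coproduct_polytope.
have vB : @convex_set R 'rV[R]_(n1 + n2) (coproduct B1 B2) by exact: conv_hull_convex.
have KC : K `<=` C.
  by move=> _ [t [y [t01 By ->]]]; move/convexP: vC; apply=> //; exact: BC.
have BK : coproduct B1 B2 `<=` K.
  move=> y By; exists 0, y; split=> //; first by rewrite lexx ler01.
  by rewrite scale0r add0r subr0 scale1r.
have Bz : coproduct B1 B2 z.
  by rewrite cpE; exists mu, p.2, q.2; split=> //; rewrite !ltW.
have Kx : K x.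
  exists 1, z; split=> //; first by rewrite lexx ler01.
  by rewrite subrr scale0r addr0 scale1r.
have [c c0 Hc] : exists2 c, c != 0 & forall y, K y -> dot c (y - z) <= 0.
  apply: supporting_hyperplane.
  - exact: cone_over_compact.
  - exact: cone_over_convex.
  - by exists x.
  move=> /(interiorS KC) Cz; rewrite -[False]/(set0 z) -freeC; split=> //.
  by exists p.2, q.2.
pose c1 := lsubmx c; pose c2 := rsubmx c.
have cE : c = row_mx c1 c2 by rewrite hsubmxK.
have {}Hc y : K y -> dot c y <= dot c z by move/Hc; rewrite dotDr dotNr subr_le0.
have ez : dot c z = (1 - mu) * dot c1 p.2 + mu * dot c2 q.2.
  by rewrite cE dot_row_mx !dotZr.
have h1 y : B1 y -> dot c1 y <= dot c z.
  move=> By; have /BK/Hc : coproduct B1 B2 (row_mx y 0).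
    by apply: sub_conv_hull; left; exists y.
  by rewrite {1}cE dot_row_mx dot0r addr0.
have h2 y : B2 y -> dot c2 y <= dot c z.
  move=> By; have /BK/Hc : coproduct B1 B2 (row_mx 0 y).
    by apply: sub_conv_hull; right; exists y.
  by rewrite {1}cE dot_row_mx dot0r add0r.
have h1p := h1 _ Bp; have h2q := h2 _ Bq.
have e1 : dot c1 p.2 = dot c z.
  apply/eqP; rewrite eq_le h1p /= -(ler_pM2l (_ : 0 < 1 - mu)) ?subr_gt0 //.
  have : mu * dot c2 q.2 <= mu * dot c z by rewrite ler_pM2l.
  by lra.
have e2 : dot c2 q.2 = dot c z.
  apply/eqP; rewrite eq_le h2q /= -(ler_pM2l mu0).
  have : (1 - mu) * dot c1 p.2 <= (1 - mu) * dot c z by rewrite ler_pM2l // subr_gt0.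
  by lra.
have [s s0 c1E] : exists2 s, 0 <= s & c1 = s *: p.1.
  by apply: Hp => y /h1; rewrite dotDr dotNr e1 subr_le0.
have [t t0 c2E] : exists2 t, 0 <= t & c2 = t *: q.1.
  by apply: Hq => y /h2; rewrite dotDr dotNr e2 subr_le0.
exists s, t; split=> //.
- apply: contra_neqT c0; rewrite negb_or !negbK => /andP[/eqP sz /eqP tz].
  by rewrite cE c1E c2E sz tz !scale0r row_mx0.
- by rewrite -!dotZl -c1E -c2E e1 e2.
- rewrite -!dotZl -c1E -c2E e1 -dot_row_mx hsubmxK -cE; exact: Hc.
Qed.

(** Elimination of the parameter: [x] is in the coproduct as soon as some [l] in
    [[0, 1]] is above all quotients coming from facets of [B2] and below all the
    complementary quotients from facets of [B1].  The inequalities for pairs of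
    facets say that the first are below the second, and the supremum of the first
    is a valid [l]. *)
Lemma coproduct_maximal :
  maximal_lattice_free (scaled_prod mu L1 L2) (coproduct B1 B2).
Proof.
split; first exact: coproduct_lattice_free m1.1 m2.1.
move=> C lfC BC; apply/seteqP; split=> // x Cx.
have c1 := polytope_compact pB1; have c2 := polytope_compact pB2.
have [S1 [E1 H1]] := maximal_lattice_free_facets aL1 c1 m1.
have [S2 [E2 H2]] := maximal_lattice_free_facets aL2 c2 m2.
have key := coproduct_facet_support lfC BC Cx H1 H2.
pose x1 := lsubmx x; pose x2 := rsubmx x.
have pos1 := exists_positive_facet aL1 c1 m1.1 B10 E1.
have pos2 := exists_positive_facet aL2 c2 m2.1 B20 E2.
have [p0 [p0S p0b _]] : exists p, [/\ p \in S1, 0 < dot p.1 p.2 & 0 <= dot p.1 0].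
  by apply: pos1 => p _ _; rewrite dot0r.
have [q0 [q0S q0b _]] : exists p, [/\ p \in S2, 0 < dot p.1 p.2 & 0 <= dot p.1 0].
  by apply: pos2 => p _ _; rewrite dot0r.
have z1 p : p \in S1 -> dot p.1 p.2 = 0 -> dot p.1 x1 <= 0.
  move=> pS pb; have [s [t [s0 t0 st e h]]] := key p q0 pS q0S.
  move: e h; rewrite pb mulr0 => /esym/eqP; rewrite mulf_eq0 (gt_eqF q0b) orbF => /eqP tz.
  move: st; rewrite tz eqxx orbF => sn; rewrite mul0r addr0 pmulr_rle0 //.
  by rewrite lt_def sn.
have z2 q : q \in S2 -> dot q.1 q.2 = 0 -> dot q.1 x2 <= 0.
  move=> qS qb; have [s [t [s0 t0 st e h]]] := key p0 q p0S qS.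
  move: e h; rewrite qb mulr0 => /eqP; rewrite mulf_eq0 (gt_eqF p0b) orbF => /eqP sz.
  move: st; rewrite sz eqxx /= => tn; rewrite !mul0r add0r pmulr_rle0 //.
  by rewrite lt_def tn.
have pq p q : p \in S1 -> q \in S2 -> 0 < dot p.1 p.2 -> 0 < dot q.1 q.2 ->
    dot q.1 x2 / dot q.1 q.2 <= 1 - dot p.1 x1 / dot p.1 p.2.
  move=> pS qS pb qb; have [s [t [s0 t0 st e h]]] := key p q pS qS.
  have sp : 0 < s.
    rewrite lt_def s0 andbT; apply: contraTneq st => sz.
    move/esym/eqP: e; rewrite sz mul0r mulf_eq0 (gt_eqF qb) orbF => /eqP ->.
    by rewrite eqxx.
  have gp : 0 < s * dot p.1 p.2 by rewrite mulr_gt0.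
  rewrite -(ler_pM2l gp) mulrBr mulr1 {1}e.
  have -> : t * dot q.1 q.2 * (dot q.1 x2 / dot q.1 q.2) = t * dot q.1 x2.
    by field; rewrite gt_eqF.
  have -> : s * dot p.1 p.2 * (dot p.1 x1 / dot p.1 p.2) = s * dot p.1 x1.
    by field; rewrite gt_eqF.
  by rewrite /x1 /x2; lra.
have [p1 [p1S p1b p1x]] := pos1 _ z1.
have [q1 [q1S q1b q1x]] := pos2 _ z2.
pose A := [set dot q.1 x2 / dot q.1 q.2 | q in [set q | q \in S2 /\ 0 < dot q.1 q.2]].
pose l := sup A.
have ubA p : p \in S1 -> 0 < dot p.1 p.2 -> ubound A (1 - dot p.1 x1 / dot p.1 p.2).
  by move=> pS pb _ [q [qS qb] <-]; exact: pq.
have lA q : q \in S2 -> 0 < dot q.1 q.2 -> dot q.1 x2 / dot q.1 q.2 <= l.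
  move=> qS qb; apply: ub_le_sup; last by exists q.
  by exists (1 - dot p1.1 x1 / dot p1.1 p1.2); exact: ubA.
have Al p : p \in S1 -> 0 < dot p.1 p.2 -> l <= 1 - dot p.1 x1 / dot p.1 p.2.
  by move=> pS pb; apply: ge_sup; [exists (dot q1.1 x2 / dot q1.1 q1.2); exists q1|exact: ubA].
have l0 : 0 <= l.
  by apply: le_trans (lA q1 q1S q1b); rewrite divr_ge0 // ltW.
have l1 : l <= 1.
  apply: le_trans (Al p1 p1S p1b) _; rewrite gerDl oppr_le0.
  by rewrite divr_ge0 // ltW.
have off1 p : p \in S1 -> 0 <= dot p.1 p.2.
  by move=> pS; move: B10; rewrite E1 => /(_ p pS); rewrite sub0r dotNr oppr_le0.
have off2 p : p \in S2 -> 0 <= dot p.1 p.2.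
  by move=> pS; move: B20; rewrite E2 => /(_ p pS); rewrite sub0r dotNr oppr_le0.
have [y1 By1 x1E] : exists2 y, B1 y & x1 = (1 - l) *: y.
  apply: (scaled_mem c1 B10 E1); first by rewrite subr_ge0.
  move=> p pS; have := off1 p pS; rewrite le_eqVlt => /orP[/eqP e|pb].
    by rewrite -e mulr0; apply: z1.
  by rewrite -ler_pdivrMr //; have := Al p pS pb; lra.
have [y2 By2 x2E] : exists2 y, B2 y & x2 = l *: y.
  apply: (scaled_mem c2 B20 E2) => // q qS.
  have := off2 q qS; rewrite le_eqVlt => /orP[/eqP e|qb].
    by rewrite -e mulr0; apply: z2.
  by rewrite -ler_pdivrMr //; exact: lA.
have [_ _ v1 _] := m1.1; have [_ _ v2 _] := m2.1.
rewrite coproductE //; exists l, y1, y2; split=> //; first by rewrite l0 l1.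
by rewrite -x1E -x2E hsubmxK.
Qed.

End CoproductMaximal.

(** * The gauge function of a convex body *)

Section GaugeOfBody.
Context {R : realType} {n : nat}.
Variables (B : set 'rV[R]_n) (f : 'rV[R]_n).
Hypotheses (cB : compact B) (vB : @convex_set R 'rV[R]_n B) (If : B° f).
Implicit Types (x y z r b : 'rV[R]_n).

Let Bf : B f. Proof. exact: interior_subset. Qed.

Let psi := gauge [set x - f | x in B].

Let G r : set R := [set rho : R | 0 < rho /\ [set x - f | x in B] (rho^-1 *: r)].

Lemma gauge_ge0 r : 0 <= psi r.
Proof.
have [G0|/set0P/negP/negPn/eqP G0] := pselect (G r !=set0).
  by apply: lb_le_inf => // rho [/ltW].
by rewrite /psi /gauge -/(G r) G0 inf0.
Qed.

Let has_lbG r : has_lbound (G r).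
Proof. by exists 0 => rho [/ltW]. Qed.

Lemma gauge_le s b : 0 <= s -> B b -> psi (s *: (b - f)) <= s.
Proof.
move=> s0 Bb; apply/ler_addgt0Pr => e e0; apply: (ge_inf (has_lbG _)).
have se : 0 < s + e by rewrite ltr_wpDl.
split=> //; exists ((s / (s + e)) *: b + (1 - s / (s + e)) *: f).
  move/convexP: vB; apply=> //.
  by rewrite divr_ge0 ?(ltW se) //= ler_pdivrMr // mul1r lerDl ltW.
by apply/rowP => i; rewrite !mxE; field; rewrite gt_eqF.
Qed.

Lemma gauge_le_norm : exists2 C, 0 < C & forall x, psi x <= C * `|x|.
Proof.
have /interiorP[e e0 He] := If.
exists (2 / e); first by rewrite divr_gt0.
move=> x; have [->|x0] := eqVneq x 0.
  by rewrite normr0 mulr0 -(scaler0 _ 0) -[X in 0 *: X](subrr f) gauge_le.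
have nx : 0 < `|x| by rewrite normr_gt0.
pose s := 2 / e * `|x|.
have s0 : 0 < s by rewrite !mulr_gt0 // invr_gt0.
have xE : x = s *: (f + s^-1 *: x - f).
  by rewrite addrC addKr scalerA mulfV ?gt_eqF // scale1r.
rewrite {1}xE -/s; apply: gauge_le; first exact: ltW.
apply: He; rewrite addrC addKr normrZ gtr0_norm ?invr_gt0 // mulrC.
by rewrite ltr_pdivrMr // /s mulrA mulrCA mulfV ?gt_eqF // mulr1 ltr_pMl // ltr1n.
Qed.

Let G_nonempty r : G r !=set0.
Proof.
have /interiorP[e e0 He] := If.
have r1 : 0 < `|r| + 1 by rewrite ltr_wpDl.
exists ((`|r| + 1) / e); split; first by rewrite divr_gt0.
exists (f + ((`|r| + 1) / e)^-1 *: r); last by rewrite addrC addKr.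
apply: He; rewrite addrC addKr normrZ gtr0_norm ?invr_gt0 ?divr_gt0 //.
by rewrite invf_div -mulrA gtr_pMr // mulrC ltr_pdivrMr // mul1r ltrDl.
Qed.

(** Compactness of [B] turns the infimum into a minimum; this is the geometric
    reading of the gauge used everywhere below. *)
Lemma gauge_attained r : exists2 b, B b & r = psi r *: (b - f).
Proof.
have hi : has_inf (G r) by split.
have [M [_ HM]] := compact_bounded cB.
pose M' := `|M| + 1 + `|f|.
have M0 : 0 < M' by rewrite /M'; have := normr_ge0 f; have := normr_ge0 M; lra.
have GM rho : G r rho -> `|r| <= rho * M'.
  move=> [rho0 [b Bb eb]].
  have -> : r = rho *: (b - f) by rewrite eb scalerA mulfV ?gt_eqF // scale1r.
  rewrite normrZ gtr0_norm // ler_wpM2l ?(ltW rho0) //.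
  have hM : M < `|M| + 1 by apply: le_lt_trans (ler_norm M) _; rewrite ltrDl.
  by have := ler_normB b f; have := HM _ hM b Bb; rewrite /M' /=; lra.
have := gauge_ge0 r; rewrite le_eqVlt => /orP[/eqP s0|s0].
  exists f => //; rewrite -s0 scale0r; apply/eqP; rewrite -normr_eq0.
  rewrite eq_le normr_ge0 andbT; apply/ler_addgt0Pr => e e0; rewrite add0r.
  have eM : 0 < e / M' by rewrite divr_gt0.
  have [rho Gr hr] := inf_adherent eM hi.
  apply: le_trans (GM _ Gr) _; rewrite -ler_pdivlMr //; apply: ltW.
  by move: hr; rewrite -[inf _]/(psi r) -s0 add0r.
set s := psi r in s0 *.
exists (f + s^-1 *: r); last by rewrite addrC addKr scalerA mulfV ?gt_eqF // scale1r.
apply: contrapT => nB.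
have : (~` B)° (f + s^-1 *: r).
  by have := closed_openC (compact_closed_rV cB); rewrite openE; apply.
move=> /interiorP[e e0 He].
have r1 : 0 < `|r| + 1 by rewrite ltr_wpDl.
pose d := e * s * s / (`|r| + 1).
have d0 : 0 < d by rewrite divr_gt0 // !mulr_gt0.
have [rho Gr hr] := inf_adherent d0 hi.
have sr : s <= rho by exact: (ge_inf (has_lbG _)).
have [rho0 [b Bb eb]] := Gr.
apply: (He b) => //.
have -> : b - (f + s^-1 *: r) = (rho^-1 - s^-1) *: r by rewrite scalerBl -eb opprD addrA.
rewrite normrZ distrC ger0_norm; last by rewrite subr_ge0 lef_pV2.
have -> : s^-1 - rho^-1 = (rho - s) / (rho * s) by field; rewrite !gt_eqF.
have h1 : rho - s < d by rewrite ltrBlDl; exact: hr.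
have rs : 0 < rho * s by rewrite mulr_gt0.
rewrite mulrAC ltr_pdivrMr //.
have h2 : (rho - s) * (`|r| + 1) < e * s * s by rewrite -ltr_pdivlMr.
have h3 : e * s * s <= e * (rho * s).
  by rewrite -mulrA ler_pM2l // ler_pM2r.
have h4 : 0 <= rho - s by rewrite subr_ge0.
by move: h2; rewrite mulrDr mulr1; lra.
Qed.

Lemma gauge_ge_norm : exists2 C, 0 < C & forall x, `|x| <= C * psi x.
Proof.
have [M [_ HM]] := compact_bounded cB.
exists (`|M| + 1 + `|f|).
  by have := normr_ge0 f; have := normr_ge0 M; lra.
move=> x; have [b Bb e] := gauge_attained x.
rewrite {1}e normrZ ger0_norm ?gauge_ge0 // mulrC ler_wpM2r ?gauge_ge0 //.
have hM : M < `|M| + 1 by apply: le_lt_trans (ler_norm M) _; rewrite ltrDl.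
by have := ler_normB b f; have := HM _ hM b Bb; rewrite /=; lra.
Qed.

Lemma gauge0 : psi 0 = 0.
Proof.
apply/eqP; rewrite eq_le gauge_ge0 andbT.
by have := gauge_le (lexx 0) Bf; rewrite scale0r.
Qed.

Lemma gaugeD x y : psi (x + y) <= psi x + psi y.
Proof.
have [b Bb eb] := gauge_attained x; have [c Bc ec] := gauge_attained y.
have := gauge_ge0 x; have := gauge_ge0 y.
set s := psi x in eb *; set t := psi y in ec * => t0 s0.
have [st|st] := eqVneq (s + t) 0.
  have s00 : s = 0 by lra.
  have t00 : t = 0 by lra.
  by rewrite eb ec s00 t00 !scale0r !addr0 gauge0.
have st0 : 0 < s + t by rewrite lt_def st addr_ge0.
have -> : x + y = (s + t) *: ((s / (s + t)) *: b + (1 - s / (s + t)) *: c - f).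
  by rewrite eb ec; apply/rowP => i; rewrite !mxE; field.
apply: gauge_le; first exact: ltW.
move/convexP: vB; apply=> //.
by rewrite divr_ge0 ?(ltW st0) //= ler_pdivrMr // mul1r lerDl.
Qed.

Lemma gaugeZ a x : 0 <= a -> psi (a *: x) <= a * psi x.
Proof.
move=> a0; have [b Bb e] := gauge_attained x.
by rewrite {1}e scalerA gauge_le // mulr_ge0 // gauge_ge0.
Qed.

(** If the gauge is below [1], the point is a proper convex combination of a point
    of [B] and the interior point [f]. *)
Lemma gauge_ge1 z : ~ B° z -> 1 <= psi (z - f).
Proof.
move=> Bz; rewrite leNgt; apply/negP => s1; apply: Bz.
have [b Bb e] := gauge_attained (z - f).
have := gauge_ge0 (z - f); set s := psi _ in s1 e * => s0.
have /interiorP[d d0 Hd] := If.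
have s1' : 0 < 1 - s by rewrite subr_gt0.
apply/interiorP; exists ((1 - s) * d); first by rewrite mulr_gt0.
move=> y yz.
have zE : z = s *: b + (1 - s) *: f.
  have -> : z = s *: (b - f) + f by rewrite -e subrK.
  by apply/rowP => i; rewrite !mxE; ring.
have -> : y = s *: b + (1 - s) *: (f + (1 - s)^-1 *: (y - z)).
  rewrite zE; apply/rowP => i; rewrite !mxE; field.
  by rewrite gt_eqF.
move/convexP: vB; apply=> //; last by rewrite s0 ltW.
apply: Hd; rewrite addrC addKr normrZ gtr0_norm ?invr_gt0 //.
by rewrite mulrC ltr_pdivrMr // mulrC.
Qed.

End GaugeOfBody.

(** * Liftings and the covering property *)

Section LatticeGroup.
Context {R : realType} {n : nat}.
Implicit Types (L G : set 'rV[R]_n) (t u v x z : 'rV[R]_n).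

Lemma lattice0 (L0 : set 'rV[R]_n) : lattice L0 -> L0 0.
Proof. by move=> [A _ ->]; exists 0 => //; rewrite map_mx0 mul0mx. Qed.

Lemma latticeD (L0 : set 'rV[R]_n) u v : lattice L0 -> L0 u -> L0 v -> L0 (u + v).
Proof.
move=> [A _ ->] [a _ <-] [b _ <-]; exists (a + b) => //.
by rewrite map_mxD mulmxDl.
Qed.

Lemma latticeN (L0 : set 'rV[R]_n) u : lattice L0 -> L0 u -> L0 (- u).
Proof. by move=> [A _ ->] [a _ <-]; exists (- a) => //; rewrite map_mxN mulNmx. Qed.

(** Names the lattice of periods [L0] of the affine lattice [L], which the
    covering property refers to. *)
Definition lattice_of (L0 L : set 'rV[R]_n) := lattice L0 /\ exists t, L = [set t + x | x in L0].

Lemma affine_latticeD (L0 L : set 'rV[R]_n) z u : lattice_of L0 L -> L z -> L0 u -> L (z + u).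
Proof.
move=> [l0 [t ->]] [x Lx <-] Lu; exists (x + u); first exact: latticeD.
by rewrite addrA.
Qed.

Lemma affine_latticeB (L0 L : set 'rV[R]_n) z w : lattice_of L0 L -> L z -> L w -> L0 (z - w).
Proof.
move=> [l0 [t ->]] [x Lx <-] [y Ly <-].
rewrite (_ : _ - _ = x + - y); first by apply: latticeD => //; exact: latticeN.
by apply/rowP => i; rewrite !mxE; ring.
Qed.

End LatticeGroup.

Lemma seq_argmin (R : realType) (T : eqType) (F : T -> R) (s : seq T) x :
  x \in s -> exists2 y, y \in s & forall z, z \in s -> F y <= F z.
Proof.
elim: s x => [//|a s IH] x _.
have [->|] := eqVneq s [::].
  by exists a; rewrite ?inE // => z; rewrite inE => /eqP ->.
case: s IH => // b s IH _; have [y ys ymin] := IH b (mem_head _ _).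
have [h|h] := leP (F a) (F y).
  exists a; first by rewrite mem_head.
  by move=> z; rewrite inE => /orP[/eqP -> //|/ymin]; exact: le_trans.
exists y; first by rewrite inE ys orbT.
by move=> z; rewrite inE => /orP[/eqP ->|/ymin //]; exact: ltW.
Qed.

(** The argument on liftings uses only that [psi] is sublinear, coercive, and at
    least [1] on [L - f]; the gauge of a lattice-free body is the instance of
    interest. *)
Section Lifting.
Context {R : realType} {n : nat}.
Variables (L L0 : set 'rV[R]_n) (f : 'rV[R]_n) (psi : 'rV[R]_n -> R).
Implicit Types (x y z r u w : 'rV[R]_n) (pi : 'rV[R]_n -> R).
Hypothesis lL : lattice_of L0 L.
Hypotheses (psi0 : psi 0 = 0) (psi_ge0 : forall x, 0 <= psi x).
Hypotheses (psiD : forall x y, psi (x + y) <= psi x + psi y).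
Hypotheses (psiZ : forall a x, 0 <= a -> psi (a *: x) <= a * psi x).
Hypothesis psi_ge1 : forall z, L z -> 1 <= psi (z - f).
Hypothesis psi_bound : exists2 C, 0 < C & forall x, `|x| <= C * psi x.
Hypothesis nLf : ~ L f.

Let lL0 : lattice L0. Proof. by case: lL. Qed.

(** The model with one continuous column and the integer columns listed with
    multiplicity.  For sublinear [psi] the continuous part may be aggregated, and
    this form of the definition makes modifications of [pi] easy to check. *)
Definition valid_pair pi := forall r (ps : seq 'rV[R]_n),
  L (f + r + \sum_(p <- ps) p) -> 1 <= psi r + \sum_(p <- ps) pi p.

Lemma psi_sum (I : Type) (s : seq I) (F : I -> 'rV[R]_n) :
  psi (\sum_(i <- s) F i) <= \sum_(i <- s) psi (F i).
Proof.
elim/big_rec2 : _ => [|i a b _ h]; first by rewrite psi0.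
by apply: le_trans (psiD _ _) _; rewrite lerD2l.
Qed.

Lemma liftingP pi :
  lifting L f psi pi <-> (forall x, 0 <= pi x) /\ valid_pair pi.
Proof.
split=> [[_ _ pi0 H]|[pi0 H]].
  split=> // r ps Lr.
  have := H 1%N (size ps) (fun=> r) (fun i => ps`_i) _ (fun=> 1) (fun=> 1%N).
  rewrite !big_ord1 mulr1 scale1r.
  rewrite (eq_bigr (fun i : 'I_(size ps) => ps`_i)); last by move=> i _; rewrite scale1r.
  rewrite (eq_bigr (fun i : 'I_(size ps) => pi ps`_i)); last by move=> i _; rewrite mulr1.
  rewrite -(big_mkord xpredT (fun i => ps`_i)) -(big_mkord xpredT (fun i => pi ps`_i)).
  rewrite -(big_nth 0 xpredT id) -(big_nth 0 xpredT pi); apply=> //.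
split=> // k l r p _ s y s0 Ls.
pose ps := flatten [seq nseq (y j) (p j) | j <- index_enum 'I_l].
have sumps (V : nmodType) (F : 'rV[R]_n -> V) : \sum_(q <- ps) F q = \sum_j F (p j) *+ y j.
  rewrite big_flatten big_map; apply: eq_bigr => j _.
  by rewrite big_nseq iter_addr_0.
have := H (\sum_i s i *: r i) ps; rewrite !sumps.
rewrite (eq_bigr (fun j => (y j)%:R *: p j)); last by move=> j _; rewrite scaler_nat.
move=> /(_ Ls) /le_trans; apply; apply: lerD.
  apply: le_trans (psi_sum _ _) _; apply: ler_sum => i _.
  by rewrite mulrC; apply: psiZ.
by apply: ler_sum => j _; rewrite mulr_natr.
Qed.

(** Coercivity of [psi] leaves finitely many candidates. *)
Lemma translate_argmin r : exists2 u, L0 u & forall v, L0 v -> psi (r + u) <= psi (r + v).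
Proof.
have [C C0 HC] := psi_bound.
have aL : affine_lattice [set r + x | x in L0] by exists r, L0.
have /finite_seqP[s es] := affine_lattice_finite (C * psi r) aL.
have mems y : (y \in s) <-> [set` s] y by [].
have rs : r \in s.
  apply/mems; rewrite -es; split; last exact: HC.
  by exists 0; rewrite ?addr0 //; exact: lattice0.
have [y /mems ys ymin] := seq_argmin psi rs.
move: ys; rewrite -es => -[[u Lu yE] _].
exists u => // v Lv; rewrite yE.
have [h|h] := leP `|r + v| (C * psi r).
  by apply: ymin; apply/mems; rewrite -es; split=> //; exists v.
apply: ltW; apply: le_lt_trans (ymin _ rs) _.
by rewrite -(ltr_pM2l C0) (lt_le_trans h).
Qed.

Definition periodized r : R := inf [set psi (r + u) | u in L0].

Let ps := periodized.

Lemma periodized_attained r : exists2 u, L0 u & ps r = psi (r + u).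
Proof.
have [u Lu umin] := translate_argmin r; exists u => //.
apply/eqP; rewrite eq_le; apply/andP; split.
  apply: ge_inf; last by exists u.
  by exists 0 => _ [v _ <-].
by apply: lb_le_inf; [exists (psi (r + u)), u|move=> _ [v Lv <-]; exact: umin].
Qed.

Lemma periodized_le r u : L0 u -> ps r <= psi (r + u).
Proof.
by move=> Lu; apply: ge_inf; [exists 0 => _ [v _ <-]|exists u].
Qed.

Lemma periodized_ge0 r : 0 <= ps r.
Proof. by have [u _ ->] := periodized_attained r. Qed.

Lemma periodizedD r d : ps (r + d) <= ps r + psi d.
Proof.
have [u Lu ->] := periodized_attained r.
by apply: le_trans (periodized_le _ Lu) _; rewrite addrAC.
Qed.

Lemma periodized_lifting : lifting L f psi ps.
Proof.
apply/liftingP; split; first exact: periodized_ge0.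
move=> r qs Lr.
have [us] : exists us, [/\ L0 us & psi (\sum_(p <- qs) p + us) <= \sum_(p <- qs) ps p].
  elim: qs {Lr} => [|q qs [us [Lus IH]]].
    by exists 0; rewrite !big_nil addr0 psi0; split=> //; exact: lattice0.
  have [u Lu qE] := periodized_attained q.
  exists (u + us); split; first exact: latticeD.
  by rewrite !big_cons addrACA qE; apply: le_trans (psiD _ _) _; rewrite lerD2l.
move=> [Lus /(lerD (lexx (psi r)))]; apply: le_trans.
apply: le_trans (psiD _ _).
rewrite -(addKr f (r + _)) addrC; apply: psi_ge1.
by rewrite !addrA; exact: affine_latticeD Lr Lus.
Qed.

(** With [f] interior to [B] and [psi] the gauge of [B - f], the inequality puts
    [f + r + u] in the region [R(B, f)]: both gauges add up to that of [w - f],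
    so the two points lie in the cone of a face containing [w]. *)
Definition covering := forall r, exists u w,
  [/\ L0 u, L w & psi (r + u) + psi (w - f - r - u) <= 1].

(** A solution with one copy of [r] and the continuous column [w - f - r - u]
    bounds any lifting below at [r] by [1 - psi (w - f - r - u)], and the covering
    property makes this at least [psi (r + u)]. *)
Lemma covering_unique_lifting : covering -> exists! pi, minimal_lifting L f psi pi.
Proof.
move=> cov.
have least pi : lifting L f psi pi -> forall r, ps r <= pi r.
  move=> /liftingP[_ vpi] r; have [u [w [Lu Lw h]]] := cov r.
  apply: le_trans (periodized_le r Lu) _.
  have := vpi (w - f - r - u) [:: r].
  rewrite !big_seq1 (_ : f + _ + r = w + - u); last by apply/rowP => i; rewrite !mxE; ring.
  move=> /(_ (affine_latticeD lL Lw (latticeN lL0 Lu))).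
  by move: h; lra.
exists ps; split; first split.
- exact: periodized_lifting.
- move=> pi lpi pi_le; apply/funext => r; apply/eqP.
  by rewrite eq_le pi_le least.
- move=> pi [lpi pmin]; apply: pmin; last exact: least.
  exact: periodized_lifting.
Qed.

(** Zorn's lemma: the pointwise infimum of a chain of liftings is a lifting, since
    a validity inequality involves finitely many values, all approximated by a
    single member of the chain. *)
Lemma minimal_lifting_below pi0 : lifting L f psi pi0 ->
  exists2 pi, minimal_lifting L f psi pi & forall x, pi x <= pi0 x.
Proof.
move=> l0.
pose T := {g : 'rV[R]_n -> R | lifting L f psi g /\ forall x, g x <= pi0 x}.
pose le (a b : T) := `[< forall x, sval b x <= sval a x >].
have [||||[g [lg gle]] gmax] := @Zorn T le.
- by move=> a; apply/asboolP.
- move=> a b c /asboolP ab /asboolP bc; apply/asboolP => x.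
  exact: le_trans (bc x) (ab x).
- move=> [a Pa] [b Pb] /asboolP /= ab /asboolP /= ba; apply: eq_exist.
  by apply/funext => x; apply/eqP; rewrite eq_le ab ba.
- move=> A totA; have [A0|/set0P[a0 Aa0]] := eqVneq A set0.
    have P0 : lifting L f psi pi0 /\ forall x, pi0 x <= pi0 x by [].
    by exists (exist _ pi0 P0) => a; rewrite A0.
  pose h x := inf [set sval a x | a in A].
  have sval_ge0 (a : T) x : 0 <= sval a x.
    by have [/liftingP[+ _] _] := svalP a; apply.
  have lb x : has_lbound [set sval a x | a in A].
    by exists 0 => _ [a _ <-].
  have h_le a x : A a -> h x <= sval a x.
    by move=> Aa; apply: ge_inf => //; exists a.
  have approx e (s : seq 'rV[R]_n) : 0 < e -> exists2 a, A a &
      forall p, p \in s -> sval a p <= h p + e.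
    move=> e0; elim: s => [|p s [a Aa Ha]]; first by exists a0.
    have hi : has_inf [set sval a p | a in A] by split=> //; exists (sval a0 p), a0.
    have [_ [b Ab <-] Hb] := inf_adherent e0 hi.
    have [/asboolP ab|/asboolP ba] := totA a b Aa Ab.
      exists b => // q; rewrite inE => /orP[/eqP ->|/Ha]; first exact: ltW.
      exact: le_trans.
    exists a => // q; rewrite inE => /orP[/eqP ->|/Ha //].
    exact: le_trans (ba p) (ltW Hb).
  have lh : lifting L f psi h.
    apply/liftingP; split=> [x|r s Lr].
      apply: lb_le_inf; first by exists (sval a0 x), a0.
      by move=> _ [a _ <-].
    apply/ler_addgt0Pr => e e0.
    have s1 : 0 < (size s)%:R + 1 :> R by rewrite ltr_wpDl.
    have [a Aa Ha] := approx (e / ((size s)%:R + 1)) s (divr_gt0 e0 s1).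
    have [/liftingP[_ va] _] := svalP a.
    apply: le_trans (va r s Lr) _; rewrite -addrA lerD2l.
    apply: (@le_trans _ _ (\sum_(p <- s) (h p + e / ((size s)%:R + 1)))).
      by rewrite !big_seq; apply: ler_sum => p /Ha.
    rewrite big_split /= lerD2l big_const_seq count_predT iter_addr_0 -[leLHS]mulr_natr.
    rewrite -mulrA ger_pMr // mulrC ler_pdivrMr // mul1r lerDl ler01.
    done.
  have Ph : lifting L f psi h /\ forall x, h x <= pi0 x.
    by split=> // x; apply: le_trans (h_le a0 x Aa0) _; have [_] := svalP a0; apply.
  by exists (exist _ h Ph) => a Aa; apply/asboolP => x; exact: h_le.
exists g => //; split=> // g' lg' g'_le.
have Pg' : lifting L f psi g' /\ forall x, g' x <= pi0 x.
  by split=> // x; apply: le_trans (gle x).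
have := gmax (exist _ g' Pg') _.
by move=> H; have [] := H (introT (asboolP _) g'_le).
Qed.

(** Throughout, [pi] is the least lifting and [opp r = z0 - f - r] the reflected
    point.  The covering property at [r] amounts to
    [ps r + ps (opp r) <= 1] for the minimum [ps] of [psi] over translates. *)
Section UniqueLifting.
Variable pi : 'rV[R]_n -> R.
Hypothesis lpi : lifting L f psi pi.
Hypothesis pi_least : forall pi', lifting L f psi pi' -> forall x, pi x <= pi' x.
Variable z0 : 'rV[R]_n.
Hypotheses (Lz0 : L z0) (z0B : psi (z0 - f) <= 1).

(** Lowering [psi] to [v] at the single point [r] cannot give a lifting, as [pi]
    is the least one; the violated inequality must use [r] some [N > 0] times. *)
Lemma least_lifting_lt r v : 0 <= v -> v < pi r ->
  exists N x, [/\ (0 < N)%N, L (f + x + N%:R *: r) & psi x + v *+ N < 1].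
Proof.
move=> v0 vr; apply: contrapT => H.
suff : pi r <= v by rewrite leNgt vr.
pose g x := if x == r then v else psi x.
suff lg : lifting L f psi g by have := pi_least lg r; rewrite /g eqxx.
apply/liftingP; split=> [x|x s Lx]; first by rewrite /g; case: eqP.
have split_sum (V : nmodType) (F : 'rV[R]_n -> V) :
    \sum_(p <- s) F p = \sum_(p <- s | p != r) F p + F r *+ count_mem r s.
  rewrite (bigID (pred1 r)) /= addrC; congr (_ + _).
  rewrite (eq_bigr (fun=> F r)) => [|p /eqP -> //].
  by rewrite big_const_seq iter_addr_0.
rewrite split_sum (eq_bigr psi) => [|p /negbTE pr]; last by rewrite /g pr.
rewrite {1}/g eqxx.
have h : psi (x + \sum_(p <- s | p != r) p) <=
    psi x + \sum_(p <- s | p != r) psi p.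
  by apply: le_trans (psiD _ _) _; rewrite lerD2l -!(big_filter s) psi_sum.
rewrite addrA; apply: (@le_trans _ _ (psi (x + \sum_(p <- s | p != r) p) + v *+ count_mem r s)); last first.
  by rewrite lerD2r.
move: Lx; rewrite (split_sum _ id) -[r *+ _]scaler_nat.
case: (count_mem r s) => [|N].
  rewrite scale0r addr0 mulr0n addr0 => Lx.
  by rewrite -(addKr f (x + _)) addrC; apply: psi_ge1; rewrite addrA.
move=> Lx; rewrite leNgt; apply/negP => lt1; apply: H.
by exists N.+1, (x + \sum_(p <- s | p != r) p); split=> //; rewrite !addrA in Lx *.
Qed.

Let opp r := z0 - f - r.

Let oppK r : opp (opp r) = r.
Proof. by rewrite /opp; apply/rowP => i; rewrite !mxE; ring. Qed.

Let cov r := ps r + ps (opp r) <= 1.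

Let cov_opp r : cov (opp r) = cov r.
Proof. by rewrite /cov oppK addrC. Qed.

(** In a solution with [N] copies of [r], all copies but one can be moved to the
    continuous column, which then reaches a translate of [opp r]. *)
Let periodized_opp r x N : (0 < N)%N -> L (f + x + N%:R *: r) ->
  ps (opp r) <= psi x + ps r *+ N.-1.
Proof.
case: N => // N _ Lx; have [u Lu ->] := periodized_attained r.
have LN : L0 (u *+ N).
  elim: N {Lx} => [|N IH]; first exact: lattice0.
  by rewrite mulrS; exact: latticeD.
have Lw : L0 (f + x + N.+1%:R *: r + u *+ N - z0).
  by apply: affine_latticeB Lz0 => //; exact: affine_latticeD Lx LN.
apply: le_trans (periodized_le _ Lw) _.
have -> : opp r + (f + x + N.+1%:R *: r + u *+ N - z0) = x + N%:R *: (r + u).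
  have -> : u *+ N = N%:R *: u by rewrite scaler_nat.
  have -> : N.+1%:R = N%:R + 1 :> R by rewrite natr1.
  by rewrite /opp; apply/rowP => i; rewrite !mxE; ring.
apply: le_trans (psiD _ _) _; rewrite lerD2l -[leRHS]mulr_natl.
exact: psiZ.
Qed.

Let pi_le_periodized r : pi r <= ps r.
Proof. exact/pi_least/periodized_lifting. Qed.

Let pi_opp r : 1 <= pi r + pi (opp r).
Proof.
have [_ vpi] := (liftingP pi).1 lpi.
have := vpi 0 [:: r; opp r]; rewrite !big_cons !big_nil psi0 !addr0 add0r; apply.
by rewrite (_ : f + _ = z0) // /opp; apply/rowP => i; rewrite !mxE; ring.
Qed.

Let psi_eq0 x : psi x = 0 -> x = 0.
Proof.
move=> x0; have [C _ /(_ x)] := psi_bound.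
by rewrite x0 mulr0 => h; apply/eqP; rewrite -normr_eq0 eq_le h normr_ge0.
Qed.

(** With [a] the common value, values [a - e] just below it are violated by some
    solution with [N] copies of [r], and [periodized_opp] bounds the sum by
    [1 + N e].  Here [N < 2 / a] whenever [e <= a / 2], so
    [N e] tends to zero.  For [a = 0] the point [r] is a period, and the lattice
    point [z0] of gauge at most [1] serves. *)
Lemma periodized_covered r : pi r = ps r -> cov r.
Proof.
move=> piE; have := periodized_ge0 r; rewrite -/ps le_eqVlt => /orP[/eqP r0|a0].
  rewrite /cov -r0 add0r.
  have [u Lu e] := periodized_attained r; move: e; rewrite -/ps -r0 => /esym/psi_eq0 e.
  have := periodized_le (opp r) (latticeN lL0 Lu).
  have -> : opp r - u = z0 - f.
    by rewrite -[RHS]subr0 -e /opp; apply/rowP => i; rewrite !mxE; ring.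
  by move/le_trans; apply.
rewrite /cov leNgt; apply/negP => cov_gt; set a := ps r in a0 piE cov_gt.
pose d := a + ps (opp r) - 1.
have d0 : 0 < d by rewrite /d; lra.
pose e := Num.min (a / 2) (d * a / 2).
have da : 0 < d * a by rewrite mulr_gt0.
have e0 : 0 < e by rewrite lt_min; apply/andP; split; lra.
have e1 : e <= a / 2 by rewrite ge_min lexx.
have e2 : e <= d * a / 2 by rewrite ge_min lexx orbT.
have [|| N [x [N0 Lx hx]]] := @least_lifting_lt r (a - e); [lra|rewrite piE; lra|].
have := periodized_opp N0 Lx; rewrite -/a => h.
have N1 : 1 <= N%:R :> R by rewrite ler1n.
have hN : N%:R * (a / 2) < 1.
  have : N%:R * (a / 2) <= N%:R * (a - e) by rewrite ler_wpM2l //; lra.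
  by move: hx; rewrite -mulr_natl; have := psi_ge0 x; lra.
have eq : a *+ N.-1 = N%:R * a - a.
  by rewrite -{2}(prednK N0) -natr1 -mulr_natl; ring.
move: h hx; rewrite eq -mulr_natl => h hx.
have : N%:R * e <= N%:R * (d * a / 2) by rewrite ler_wpM2l.
have : d * (N%:R * (a / 2)) < d * 1 by rewrite ltr_pM2l.
rewrite /d; nra.
Qed.

(** Validity gives [1 - pi (opp r) <= pi r]; equality of [pi] and [ps] at the
    reflected point would make it covered, hence [r] as well. *)
Let uncovered_gt r : ~~ cov r -> 1 - ps (opp r) < pi r.
Proof.
move=> ncov; have h1 := pi_opp r; have h2 := pi_le_periodized (opp r).
suff : pi (opp r) != ps (opp r) by rewrite neq_lt; lra.
by apply: contra ncov => /eqP/periodized_covered; rewrite cov_opp.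
Qed.

(** A value [v] of at least [1 - ps (opp r)] is not violated with [N = 1], and a
    value of at least [1 / 2] is not violated with [N >= 2]. *)
Let uncovered_half r : ~~ cov r -> pi r <= 1 / 2.
Proof.
move=> ncov; rewrite leNgt; apply/negP => half.
pose v := Num.max (1 / 2) (1 - ps (opp r)).
have v2 : 1 / 2 <= v by rewrite le_max lexx.
have v3 : 1 - ps (opp r) <= v by rewrite le_max lexx orbT.
have [||[|[|N]] [x [// _ Lx hx]]] := @least_lifting_lt r v; first lra.
- by rewrite gt_max half uncovered_gt.
- by have := periodized_opp (ltn0Sn 0) Lx; rewrite mulr0n addr0; move: hx; rewrite mulr1n; lra.
- have := psi_ge0 x; move: hx; rewrite -mulr_natl -!natr1.
  have := ler0n R N; nra.
Qed.

(** The values at [r] and [opp r] are at most [1 / 2] and sum to at least [1], so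
    [pi r = 1 / 2].  Values [v] slightly below are violated with exactly [N = 2],
    by a continuous part of cost below [1 - 2 v]; letting [v] tend to [1 / 2], a
    translate of [z0 - f - 2 r] has gauge zero. *)
Lemma uncovered_half_lattice r : ~~ cov r -> L (f + 2 *: r).
Proof.
move=> ncov; have ncov' : ~~ cov (opp r) by rewrite cov_opp.
have h1 := uncovered_half ncov; have h2 := uncovered_half ncov'.
have h3 := pi_opp r; have h4 := uncovered_gt ncov.
pose q := z0 - f - 2 *: r.
suff : ps q <= 0.
  move=> q0; have [u Lu e] := periodized_attained q.
  have /psi_eq0 qu : psi (q + u) = 0.
    by apply/eqP; rewrite eq_le psi_ge0 andbT -e.
  rewrite (_ : f + 2 *: r = z0 + u); first exact: affine_latticeD Lz0 Lu.
  by rewrite -[LHS]addr0 -qu /q; apply/rowP => i; rewrite !mxE; ring.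
rewrite leNgt; apply/negP => q0.
(* The three bounds exclude [N >= 3], exclude [N = 1], and make [1 - 2 v] smaller
   than [ps q]. *)
pose v := Num.max (Num.max (2 / 5) (1 - ps (opp r))) (1 / 2 - ps q / 4).
have v1 : 2 / 5 <= v by rewrite !le_max lexx.
have v2 : 1 - ps (opp r) <= v by rewrite !le_max lexx orbT.
have v3 : 1 / 2 - ps q / 4 <= v by rewrite !le_max lexx orbT.
have v4 : v < pi r by rewrite !gt_max; apply/andP; split; [apply/andP; split|]; lra.
have [||[|[|[|N]]] [x [// _ Lx hx]]] := @least_lifting_lt r v; [lra|by []|..].
- by have := periodized_opp (ltn0Sn 0) Lx; rewrite mulr0n addr0; move: hx; rewrite mulr1n; lra.
- have := periodized_le q (affine_latticeB lL Lx Lz0).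
  rewrite (_ : q + _ = x); last by rewrite /q; apply/rowP => i; rewrite !mxE; ring.
  by rewrite -/ps; move: hx; rewrite mulr2n; lra.
- have := psi_ge0 x; move: hx; rewrite -mulr_natl -!natr1.
  have := ler0n R N; nra.
Qed.

(** Failure of the covering property is stable under small moves of [r], because
    [ps] is Lipschitz; but [f + 2 r] would be a lattice point at all of them. *)
Lemma least_lifting_covering : covering.
Proof.
move=> r; suff : cov r.
  rewrite /cov.
  have [u Lu ->] := periodized_attained r.
  have [w Lw ->] := periodized_attained (opp r).
  exists u, (z0 + (u + w)); split=> //.
    by apply: (affine_latticeD lL Lz0); exact: latticeD.
  by rewrite (_ : z0 + _ - _ - _ - _ = opp r + w) // /opp; apply/rowP => i; rewrite !mxE; ring.
apply: contrapT => /negP ncov.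
have [e e0 He] := lattice_discrete lL0.
pose d := z0 - f.
have d0 : d != 0 by rewrite subr_eq0; apply: contra_not_neq nLf => <-.
have nd : 0 < `|d| by rewrite normr_gt0.
have gap : 0 < ps r + ps (opp r) - 1 by move: ncov; rewrite /cov -ltNge; lra.
pose P := psi d + psi (- d) + 1.
have P0 : 0 < P by have := psi_ge0 d; have := psi_ge0 (- d); rewrite /P; lra.
pose t := Num.min ((ps r + ps (opp r) - 1) / 2 / P) (e / 4 / `|d|).
have t0 : 0 < t by rewrite lt_min !divr_gt0.
have t1 : t * P <= (ps r + ps (opp r) - 1) / 2.
  by rewrite -ler_pdivlMr // ge_min lexx.
have t2 : t * `|d| <= e / 4.
  by rewrite -ler_pdivlMr // ge_min lexx orbT.
have ncov' : ~~ cov (r + t *: d).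
  rewrite /cov -ltNge.
  have := periodizedD (r + t *: d) (t *: - d).
  rewrite (_ : r + _ + _ = r); last by apply/rowP => i; rewrite !mxE; ring.
  have := periodizedD (opp (r + t *: d)) (t *: d).
  rewrite (_ : _ + t *: d = opp r); last by rewrite /opp; apply/rowP => i; rewrite !mxE; ring.
  rewrite -/ps; have := psiZ d (ltW t0); have := psiZ (- d) (ltW t0).
  by move: t1; rewrite /P; lra.
have := affine_latticeB lL (uncovered_half_lattice ncov') (uncovered_half_lattice ncov).
rewrite (_ : _ - _ = (2 * t) *: d); last by apply/rowP => i; rewrite !mxE; ring.
have h : `|(2 * t) *: d| < e.
  by rewrite normrZ gtr0_norm ?mulr_gt0 // -mulrA; lra.
move=> /He /(_ h) /eqP; rewrite scaler_eq0 (negbTE d0) orbF.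
by rewrite gt_eqF // mulr_gt0.
Qed.

End UniqueLifting.

Lemma unique_lifting_covering z0 : L z0 -> psi (z0 - f) <= 1 ->
  (exists! pi, minimal_lifting L f psi pi) -> covering.
Proof.
move=> Lz0 z0B [pi [[lpi _] piU]]; apply: (least_lifting_covering lpi _ Lz0 z0B).
move=> pi' lpi' x.
by have [pi'' mpi'' /(_ x)] := minimal_lifting_below lpi'; rewrite (piU _ mpi'').
Qed.

End Lifting.

(** * The covering property of the coproduct *)

Lemma lipschitz_continuous (R : realType) (h : R -> R) (K : R) : 0 <= K ->
  (forall x y, `|h x - h y| <= K * `|x - y|) -> continuous (h : R^o -> R^o).
Proof.
move=> K0 hK x; apply/cvgrPdist_lt => e e0.
apply/nbhs_ballP; exists (e / (K + 1)) => [|y]; first by rewrite /= divr_gt0 // ltr_wpDl.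
rewrite /ball_ /= ltr_pdivlMr ?ltr_wpDl // => xy.
apply: le_lt_trans (hK x y) _; have := normr_ge0 (x - y); nra.
Qed.

(** As [h2] takes its values in [[0, 1]], the difference [h2 (h1 s) - s] changes
    sign on that interval. *)
Lemma lipschitz_fixed_point (R : realType) (h1 h2 : R -> R) (K1 K2 : R) :
  0 <= K1 -> 0 <= K2 ->
  (forall s t, `|h1 s - h1 t| <= K1 * `|s - t|) ->
  (forall s t, `|h2 s - h2 t| <= K2 * `|s - t|) ->
  (forall s, 0 <= h2 s <= 1) -> exists s, h2 (h1 s) = s.
Proof.
move=> K10 K20 lip1 lip2 h01; pose k s := h2 (h1 s) - s.
have kcont : continuous (k : R^o -> R^o).
  apply: (@lipschitz_continuous _ _ (K2 * K1 + 1)) => [|s t].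
    by rewrite addr_ge0 // mulr_ge0.
  have -> : k s - k t = (h2 (h1 s) - h2 (h1 t)) - (s - t) by rewrite /k; ring.
  apply: le_trans (ler_normB _ _) _; rewrite mulrDl mul1r lerD2r.
  by apply: le_trans (lip2 _ _) _; rewrite -mulrA ler_wpM2l.
have [||s _ ks] := @IVT _ k 0 1 0 ler01.
- exact: continuous_subspaceT.
- rewrite ge_min le_max /k subr0; have := h01 (h1 0); have := h01 (h1 1).
  by move=> /andP[_ a] /andP[b _]; rewrite b /= subr_le0 a orbT.
by exists s; apply/eqP; rewrite -subr_eq0; exact/eqP.
Qed.

Section Coverings.
Context {R : realType} {n : nat}.
Variables (L L0 B : set 'rV[R]_n) (f : 'rV[R]_n).
Hypotheses (lL : lattice_of L0 L) (cB : compact B) (lfB : lattice_free L B) (If : B° f).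

Let psi := gauge [set x - f | x in B].
Let ps := periodized L0 psi.

Let vB : @convex_set R 'rV[R]_n B. Proof. by case: lfB. Qed.

Let notin z : L z -> ~ B° z.
Proof.
by move=> Lz Iz; have [_ _ _ freeB] := lfB; rewrite -[False]/(set0 z) -freeB.
Qed.

Let ge1 z : L z -> 1 <= psi (z - f).
Proof. by move=> Lz; apply: gauge_ge1 => //; exact: notin. Qed.

Let nLf : ~ L f. Proof. by move=> /notin. Qed.

Lemma covering_unique_gauge_lifting : covering L L0 f psi ->
  exists! pi, minimal_lifting L f psi pi.
Proof.
apply: covering_unique_lifting => //.
- exact: gauge0.
- exact: gauge_ge0.
- exact: gaugeD.
- exact: gaugeZ.
- exact: gauge_ge_norm.
Qed.

(** The theory of least liftings needs a lattice point in [B]; maximality provides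
    one. *)
Lemma unique_gauge_lifting_covering : maximal_lattice_free L B ->
  (exists! pi, minimal_lifting L f psi pi) -> covering L L0 f psi.
Proof.
move=> mB; have aL : affine_lattice L by have [l0 [t ->]] := lL; exists t, L0.
have [z0 [Lz0 Bz0]] : exists z0, L z0 /\ B z0.
  have [z Lz] := affine_lattice_nonempty aL.
  have [Bz|Bz] := pselect (B z); first by exists z.
  by have [b [e [z0 [_ _ Lz0 Bz0 _]]]] := visible_lattice_point aL cB mB Bz; exists z0.
apply: (unique_lifting_covering lL _ _ _ _ _ _ _ Lz0) => //.
- exact: gauge0.
- exact: gauge_ge0.
- exact: gaugeD.
- exact: gaugeZ.
- exact: gauge_ge_norm.
- by have := gauge_le vB If ler01 Bz0; rewrite scale1r.
Qed.

Lemma gauge_mem a r : 0 <= a -> psi r <= a -> exists2 b, B b & r = a *: (b - f).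
Proof.
move=> a0 ra; have [b Bb rE] := gauge_attained cB If r.
have [az|an] := eqVneq a 0.
  exists b => //; have r0 : psi r = 0.
    by apply/eqP; rewrite eq_le -{1}az ra gauge_ge0.
  by rewrite rE -/psi r0 az.
have ap : 0 < a by rewrite lt_def an.
exists ((psi r / a) *: b + (1 - psi r / a) *: f).
  move/convexP: vB; apply=> //; first exact: (interior_subset If).
  by rewrite divr_ge0 ?gauge_ge0 //= ler_pdivrMr // mul1r.
by rewrite {1}rE -/psi; apply/rowP => i; rewrite !mxE; field.
Qed.

Hypothesis cov : covering L L0 f psi.

(** The covering property in terms of points of [B]: the translate of [r] that
    realises the minimum [ps r] can itself be chosen, and the height of the
    complementary point is then [1 - ps r]. *)
Lemma covering_decomposition r : 0 <= ps r <= 1 /\ exists u w b b',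
  [/\ L0 u, L w, B b, B b' &
      r + u = ps r *: (b - f) /\ w - f - r - u = (1 - ps r) *: (b' - f)].
Proof.
have p0 := gauge0 vB If; have pge0 := gauge_ge0 B f.
have pb := gauge_ge_norm cB If.
have [u [w [Lu Lw h]]] := cov r.
have ps0 : 0 <= ps r by exact: (periodized_ge0 lL pge0 pb).
have psle : ps r <= psi (r + u) by exact: (periodized_le pge0).
have [v Lv psE] : exists2 v, L0 v & ps r = psi (r + v) by exact: (periodized_attained lL pge0 pb).
have h' := pge0 (w - f - r - u); rewrite -/psi in h'.
have ps1 : ps r <= 1 by lra.
split; first by rewrite ps0.
have [b Bb bE] : exists2 b, B b & r + v = ps r *: (b - f).
  by apply: gauge_mem => //; rewrite psE.
have [b' Bb' b'E] : exists2 b, B b & w - f - r - u = (1 - ps r) *: (b - f).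
  by apply: gauge_mem; lra.
have [l0 _] := lL.
exists v, (w + (v - u)), b, b'; split=> //.
  by apply: (affine_latticeD lL Lw); apply: latticeD => //; exact: latticeN.
split=> //; rewrite -b'E; apply/rowP => i; rewrite !mxE; ring.
Qed.

Lemma periodized_lipschitz : exists2 C, 0 < C & forall x y, `|ps x - ps y| <= C * `|x - y|.
Proof.
have p0 := gauge0 vB If; have pge0 := gauge_ge0 B f.
have pb := gauge_ge_norm cB If.
have [C C0 HC] := gauge_le_norm vB If; exists C => // x y.
have step x' y' : ps x' - ps y' <= C * `|x' - y'|.
  rewrite lerBlDl; apply: le_trans (lerD (lexx _) (HC _)).
  rewrite -{1}(subrK y' x') addrC.
  exact: (periodizedD lL pge0 (gaugeD cB vB If) pb).
by rewrite ler_norml step andbT lerNl opprB distrC step.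
Qed.

End Coverings.

Section CoproductCovering.
Context {R : realType} {n1 n2 : nat}.
Variables (L1 G1 B1 : set 'rV[R]_n1) (L2 G2 B2 : set 'rV[R]_n2) (mu : R).
Variables (G : set 'rV[R]_(n1 + n2)) (g : 'rV[R]_(n1 + n2)).
Hypotheses (lL1 : lattice_of G1 L1) (lL2 : lattice_of G2 L2).
Hypothesis lL : lattice_of G (scaled_prod mu L1 L2).
Hypotheses (pB1 : polytope B1) (pB2 : polytope B2) (B10 : B1 0) (B20 : B2 0).
Hypotheses (mu0 : 0 < mu) (mu1 : mu < 1).
Hypotheses (lf1 : lattice_free L1 B1) (lf2 : lattice_free L2 B2).
Hypothesis Ig : (coproduct B1 B2)° g.

Let v1 : @convex_set R 'rV[R]_n1 B1. Proof. exact: polytope_convex. Qed.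
Let v2 : @convex_set R 'rV[R]_n2 B2. Proof. exact: polytope_convex. Qed.
Let c1 : compact B1. Proof. exact: polytope_compact. Qed.
Let c2 : compact B2. Proof. exact: polytope_compact. Qed.

Let g1 := lsubmx g.
Let g2 := rsubmx g.

Let scale_mem m (K : set 'rV[R]_m) x t : @convex_set R 'rV[R]_m K -> K 0 ->
  K x -> 0 <= t <= 1 -> K (t *: x).
Proof.
move=> /convexP cK K0 Kx t01.
by have := cK x 0 t Kx K0 t01; rewrite scaler0 addr0.
Qed.

Lemma coproduct_interior_l : B1° g1.
Proof.
have /interiorP[e e0 He] := Ig; apply/interiorP; exists e => // y yg.
have : coproduct B1 B2 (row_mx y g2).
  apply: He; rewrite -(hsubmxK g) -/g1 -/g2 opp_row_mx add_row_mx subrr.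
  apply: le_lt_trans yg; apply: norm_le_coord => // i.
  rewrite mxE; case: splitP => j _; first exact: coord_le_norm.
  by rewrite mxE normr0.
rewrite coproductE // => -[t [x [z [t01 Bx _ /eq_row_mx[-> _]]]]].
by apply: scale_mem => //; move: t01; lra.
Qed.

Lemma coproduct_interior_r : B2° g2.
Proof.
have /interiorP[e e0 He] := Ig; apply/interiorP; exists e => // y yg.
have : coproduct B1 B2 (row_mx g1 y).
  apply: He; rewrite -(hsubmxK g) -/g1 -/g2 opp_row_mx add_row_mx subrr.
  apply: le_lt_trans yg; apply: norm_le_coord => // i.
  rewrite mxE; case: splitP => j _; last exact: coord_le_norm.
  by rewrite mxE normr0.
by rewrite coproductE // => -[t [x [z [t01 _ Bz /eq_row_mx[_ ->]]]]]; exact: scale_mem.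
Qed.

Let psi := gauge [set x - g | x in coproduct B1 B2].

(** The scaled points [a1 b1] and [a2 b2] form [a1 + a2] times a point of the
    coproduct with parameter [a2 / (a1 + a2)]. *)
Lemma coproduct_gauge_le a1 a2 b1 b2 : 0 <= a1 -> 0 <= a2 -> B1 b1 -> B2 b2 ->
  psi (row_mx (a1 *: b1) (a2 *: b2) - (a1 + a2) *: g) <= a1 + a2.
Proof.
move=> a10 a20 Bb1 Bb2; have vB : @convex_set R 'rV[R]_(n1 + n2) (coproduct B1 B2).
  exact: conv_hull_convex.
have [az|an] := eqVneq (a1 + a2) 0.
  have a1z : a1 = 0 by lra.
  have a2z : a2 = 0 by lra.
  by rewrite a1z a2z !scale0r row_mx0 addr0 scale0r subr0 /psi (gauge0 vB Ig).
have ap : 0 < a1 + a2 by rewrite lt_def an addr_ge0.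
have -> : row_mx (a1 *: b1) (a2 *: b2) - (a1 + a2) *: g =
    (a1 + a2) *: (row_mx ((1 - a2 / (a1 + a2)) *: b1) ((a2 / (a1 + a2)) *: b2) - g).
  rewrite scalerBr scale_row_mx !scalerA mulrBr mulr1 mulrC divfK //.
  by rewrite addrK.
apply: gauge_le => //; first exact: ltW.
rewrite coproductE //; exists (a2 / (a1 + a2)), b1, b2; split=> //.
by rewrite divr_ge0 ?(ltW ap) //= ler_pdivrMr // mul1r lerDr.
Qed.

Let psi1 := gauge [set x - g1 | x in B1].
Let psi2 := gauge [set x - g2 | x in B2].
Hypotheses (cov1 : covering L1 G1 g1 psi1) (cov2 : covering L2 G2 g2 psi2).

(** Substituting the first equation into the second leaves a fixed point problem
    for [s2] alone; heights are Lipschitz functions with values in [[0, 1]]. *)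
Lemma matching_heights (r1 : 'rV[R]_n1) (r2 : 'rV[R]_n2) : exists s1 s2,
  s1 = periodized G1 psi1 ((1 - mu)^-1 *: (r1 + (mu * s2) *: g1)) /\
  s2 = periodized G2 psi2 (mu^-1 *: (r2 + ((1 - mu) * s1) *: g2)).
Proof.
have I1 := coproduct_interior_l; have I2 := coproduct_interior_r.
have m1 : 0 < 1 - mu by rewrite subr_gt0.
pose h1 s := periodized G1 psi1 ((1 - mu)^-1 *: (r1 + (mu * s) *: g1)).
pose h2 s := periodized G2 psi2 (mu^-1 *: (r2 + ((1 - mu) * s) *: g2)).
have [C1 C10 H1] := periodized_lipschitz lL1 c1 lf1 I1.
have [C2 C20 H2] := periodized_lipschitz lL2 c2 lf2 I2.
pose K1 := C1 * ((1 - mu)^-1 * mu * `|g1|).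
pose K2 := C2 * (mu^-1 * (1 - mu) * `|g2|).
have K10 : 0 <= K1 by rewrite !mulr_ge0 // ?invr_ge0 ltW.
have K20 : 0 <= K2 by rewrite !mulr_ge0 // ?invr_ge0 ltW.
have lip1 s t : `|h1 s - h1 t| <= K1 * `|s - t|.
  apply: le_trans (H1 _ _) _.
  rewrite (_ : _ - _ = ((1 - mu)^-1 * mu * (s - t)) *: g1); last first.
    by apply/rowP => i; rewrite !mxE; ring.
  rewrite normrZ normrM (gtr0_norm (_ : 0 < _ * mu)) ?mulr_gt0 ?invr_gt0 //.
  by rewrite le_eqVlt; apply/orP; left; apply/eqP; rewrite /K1; ring.
have lip2 s t : `|h2 s - h2 t| <= K2 * `|s - t|.
  apply: le_trans (H2 _ _) _.
  rewrite (_ : _ - _ = (mu^-1 * (1 - mu) * (s - t)) *: g2); last first.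
    by apply/rowP => i; rewrite !mxE; ring.
  rewrite normrZ normrM (gtr0_norm (_ : 0 < _ * (1 - mu))) ?mulr_gt0 ?invr_gt0 //.
  by rewrite le_eqVlt; apply/orP; left; apply/eqP; rewrite /K2; ring.
have [s sE] : exists s, h2 (h1 s) = s.
  apply: (lipschitz_fixed_point K10 K20 lip1 lip2) => s.
  by have [+ _] := covering_decomposition lL2 c2 lf2 I2 cov2 (mu^-1 *: (r2 + ((1 - mu) * s) *: g2)).
by exists (h1 s), s.
Qed.

(** Write the displaced points of the factors as [s_i (b_i - g_i)] up to periods.
    Multiplied by [1 - mu] and [mu], the displacements turn the coefficient of
    each [g_i] into the common height [(1 - mu) s1 + mu s2], so the two components
    form one point relative to [g]; likewise for the complementary points. *)
Lemma coproduct_covering : covering (scaled_prod mu L1 L2) G g psi.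
Proof.
move=> r; have I1 := coproduct_interior_l; have I2 := coproduct_interior_r.
have m1 : 0 < 1 - mu by rewrite subr_gt0.
have [s1 [s2 [E1 E2]]] := matching_heights (lsubmx r) (rsubmx r).
have [s101 [u1 [w1 [b1 [b1' [Gu1 Lw1 Bb1 Bb1' [e1 e1']]]]]]] :=
  covering_decomposition lL1 c1 lf1 I1 cov1 ((1 - mu)^-1 *: (lsubmx r + (mu * s2) *: g1)).
have [s201 [u2 [w2 [b2 [b2' [Gu2 Lw2 Bb2 Bb2' [e2 e2']]]]]]] :=
  covering_decomposition lL2 c2 lf2 I2 cov2 (mu^-1 *: (rsubmx r + ((1 - mu) * s1) *: g2)).
rewrite -E1 in s101 e1 e1'; rewrite -E2 in s201 e2 e2'.
pose u := row_mx ((1 - mu) *: u1) (mu *: u2).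
pose w := row_mx ((1 - mu) *: w1) (mu *: w2).
have Lw : scaled_prod mu L1 L2 w by exists w1, w2.
have Gu : G u.
  have : scaled_prod mu L1 L2 (row_mx ((1 - mu) *: (w1 + u1)) (mu *: (w2 + u2))).
    exists (w1 + u1), (w2 + u2); split=> //.
      exact: affine_latticeD lL1 Lw1 Gu1.
    exact: affine_latticeD lL2 Lw2 Gu2.
  move=> /(affine_latticeB lL) /(_ Lw); rewrite opp_row_mx add_row_mx.
  by rewrite !scalerDr ![_ *: w1 + _]addrC ![_ *: w2 + _]addrC !addrK.
have muE : mu != 0 by rewrite gt_eqF.
have m1E : 1 - mu != 0 by rewrite gt_eqF.
have ru : r + u = row_mx (((1 - mu) * s1) *: b1) ((mu * s2) *: b2) -
    ((1 - mu) * s1 + mu * s2) *: g.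
  have d1 : lsubmx r + (1 - mu) *: u1 =
      ((1 - mu) * s1) *: b1 - ((1 - mu) * s1 + mu * s2) *: g1.
    have -> : lsubmx r + (1 - mu) *: u1 = (1 - mu) *:
       ((1 - mu)^-1 *: (lsubmx r + (mu * s2) *: g1) + u1) - (mu * s2) *: g1.
      by apply/rowP => i; rewrite !mxE; field.
    by rewrite e1; apply/rowP => i; rewrite !mxE; ring.
  have d2 : rsubmx r + mu *: u2 =
      (mu * s2) *: b2 - ((1 - mu) * s1 + mu * s2) *: g2.
    have -> : rsubmx r + mu *: u2 = mu *:
       (mu^-1 *: (rsubmx r + ((1 - mu) * s1) *: g2) + u2) - ((1 - mu) * s1) *: g2.
      by apply/rowP => i; rewrite !mxE; field.
    by rewrite e2; apply/rowP => i; rewrite !mxE; ring.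
  rewrite -{1}(hsubmxK r) -{1}(hsubmxK g) add_row_mx d1 d2.
  by rewrite scale_row_mx opp_row_mx add_row_mx.
have rw : w - g - r - u = row_mx (((1 - mu) * (1 - s1)) *: b1') ((mu * (1 - s2)) *: b2') -
    ((1 - mu) * (1 - s1) + mu * (1 - s2)) *: g.
  have d1 : (1 - mu) *: w1 - g1 - lsubmx r - (1 - mu) *: u1 =
      ((1 - mu) * (1 - s1)) *: b1' - ((1 - mu) * (1 - s1) + mu * (1 - s2)) *: g1.
    have -> : (1 - mu) *: w1 - g1 - lsubmx r - (1 - mu) *: u1 = (1 - mu) *:
       (w1 - g1 - (1 - mu)^-1 *: (lsubmx r + (mu * s2) *: g1) - u1) - (mu * (1 - s2)) *: g1.
      by apply/rowP => i; rewrite !mxE; field.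
    by rewrite e1'; apply/rowP => i; rewrite !mxE; ring.
  have d2 : mu *: w2 - g2 - rsubmx r - mu *: u2 =
      (mu * (1 - s2)) *: b2' - ((1 - mu) * (1 - s1) + mu * (1 - s2)) *: g2.
    have -> : mu *: w2 - g2 - rsubmx r - mu *: u2 = mu *:
       (w2 - g2 - mu^-1 *: (rsubmx r + ((1 - mu) * s1) *: g2) - u2) -
       ((1 - mu) * (1 - s1)) *: g2.
      by apply/rowP => i; rewrite !mxE; field.
    by rewrite e2'; apply/rowP => i; rewrite !mxE; ring.
  rewrite -{1}(hsubmxK r) -{1 2}(hsubmxK g) scale_row_mx !opp_row_mx !add_row_mx.
  by rewrite d1 d2.
exists u, w; split=> //; rewrite rw ru.
have h : (1 - mu) * s1 + mu * s2 + ((1 - mu) * (1 - s1) + mu * (1 - s2)) = 1 by ring.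
have /andP[s10 s11] := s101; have /andP[s20 s21] := s201.
rewrite -[leRHS]h; apply: lerD; apply: coproduct_gauge_le => //;
  by rewrite mulr_ge0 ?subr_ge0 // ltW.
Qed.

End CoproductCovering.

Lemma coproduct_unique_lifting (R : realType) (n1 n2 : nat)
    (L1 B1 : set 'rV[R]_n1) (L2 B2 : set 'rV[R]_n2) (mu : R) :
  affine_lattice L1 -> affine_lattice L2 -> polytope B1 -> polytope B2 ->
  B1 0 -> B2 0 -> 0 < mu -> mu < 1 ->
  maximal_lattice_free L1 B1 -> unique_lifting L1 B1 ->
  maximal_lattice_free L2 B2 -> unique_lifting L2 B2 ->
  unique_lifting (scaled_prod mu L1 L2) (coproduct B1 B2).
Proof.
move=> aL1 aL2 pB1 pB2 B10 B20 m0 m1 mB1 u1 mB2 u2 g Ig.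
have lat m (L : set 'rV[R]_m) : affine_lattice L -> exists G, lattice_of G L.
  by move=> [t [G [lG ->]]]; exists G; split=> //; exists t.
have [G1 lL1] := lat _ _ aL1; have [G2 lL2] := lat _ _ aL2.
have [G lL] := lat _ _ (scaled_prod_affine_lattice m0 m1 aL1 aL2).
have I1 := coproduct_interior_l pB1 pB2 B10 B20 Ig.
have I2 := coproduct_interior_r pB1 pB2 B10 B20 Ig.
have c1 := polytope_compact pB1; have c2 := polytope_compact pB2.
have cov1 := unique_gauge_lifting_covering lL1 c1 mB1.1 I1 mB1 (u1 _ I1).
have cov2 := unique_gauge_lifting_covering lL2 c2 mB2.1 I2 mB2 (u2 _ I2).
apply: (covering_unique_gauge_lifting lL) => //.
- by apply: polytope_compact; exact: coproduct_polytope.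
- by apply: coproduct_lattice_free => //; [exact: mB1.1|exact: mB2.1].
- exact: (coproduct_covering lL1 lL2 lL pB1 pB2 B10 B20 m0 m1 mB1.1 mB2.1 Ig cov1 cov2).
Qed.

Theorem theorem5p3 (R : realType) (n1 n2 : nat)
  (L1 : set 'rV[R]_n1) (L2 : set 'rV[R]_n2)
  (B1 : set 'rV[R]_n1) (B2 : set 'rV[R]_n2) (mu : R) :
  affine_lattice L1 -> affine_lattice L2 ->
  polytope B1 -> full_dimensional B1 -> B1 0 ->
  polytope B2 -> full_dimensional B2 -> B2 0 ->
  0 < mu -> mu < 1 ->
  let B := coproduct B1 B2 in
  let L := scaled_prod mu L1 L2 in
  [/\ polytope B, full_dimensional B & affine_lattice L] /\
  [/\ (* (a) *)
      lattice_free L1 B1 -> lattice_free L2 B2 -> lattice_free L B,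
      (* (b) *)
      maximal_lattice_free L1 B1 -> maximal_lattice_free L2 B2 ->
      maximal_lattice_free L B
    & (* (c) *)
      maximal_lattice_free L1 B1 -> unique_lifting L1 B1 ->
      maximal_lattice_free L2 B2 -> unique_lifting L2 B2 ->
      maximal_lattice_free L B /\ unique_lifting L B].
Proof.
move=> aL1 aL2 pB1 fB1 B10 pB2 fB2 B20 m0 m1 B L.
split; first split.
- exact: coproduct_polytope.
- exact: coproduct_full_dimensional.
- exact: scaled_prod_affine_lattice.
split.
- by move=> lf1 lf2; exact: coproduct_lattice_free.
- by move=> mB1 mB2; exact: coproduct_maximal.
- move=> mB1 u1 mB2 u2; split; first exact: coproduct_maximal.
  exact: coproduct_unique_lifting.
Qed.
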